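(* Let $\Omega\subset\mathbb{R}^n$ be a bounded domain (open and connected) with Lipschitz boundary, and let $E\subset\Omega$ be measurable with $|E|>0$. Let $Q>0$ be a constant such that $\|u-u_\Omega\|_{L^2(\Omega)}\le Q\|\nabla u\|_{L^2(\Omega)}$ for every $u\in W^{1,2}(\Omega)$. Then, for every $u\in W^{2,2}(\Omega)$, $$\left\|u-\bigl(u_E+(\nabla u)_E\cdot(x-x_E)\bigr)\right\|_{W^{2,2}(\Omega)}\le\left(1+\left(2\frac{|\Omega|}{|E|}\bigl(1+(\mathrm{diam}\,\Omega)^2\bigr)\right)^{\frac12}\right)(1+Q^2+Q^4)^{\frac12}\|\nabla^2u\|_{L^2(\Omega)}.$$
   Context: For a measurable set $F$ of positive measure, $f_F=\frac{1}{|F|}\int_F f$ denotes the average of $f$ over $F$ (also for vector valued $f$), $|F|$ is the Lebesgue measure, and $x_F=\frac{1}{|F|}\int_F x\,dx$ is the center of mass of $F$. Norm: $\|u\|_{W^{2,2}(\Omega)}=\left(\int_\Omega u^2+|\nabla u|^2+|\nabla^2u|^2\right)^{1/2}$, with the Euclidean (Frobenius) norm on vectors and matrices. The constant $Q$ exists by the classical Poincaré inequality. *)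

(* Defs.v *)
From HB Require Import structures.
From mathcomp Require Import all_boot all_order all_algebra.
From mathcomp Require Import all_classical all_reals all_analysis.

Set Implicit Arguments.
Unset Strict Implicit.
Unset Printing Implicit Defensive.

Import Order.TTheory GRing.Theory Num.Theory.
Import numFieldNormedType.Exports.

Local Open Scope classical_set_scope.
Local Open Scope ring_scope.

(* R^n with n >= 1 is 'rV[R]_n.+1. Its Lebesgue measure is the restriction of
   the outer measure given by countable covers by half-open boxes to the
   Caratheodory measurable sets, so "measurable" means Lebesgue measurable.
   (In dimension 0 every box would have volume 1, whence the n.+1.) *)
Section lebesgue_outer_measure.
Local Open Scope ereal_scope.
Context {R : realType} {n : nat}.
Implicit Types (a b : 'rV[R]_n.+1) (X : set 'rV[R]_n.+1).

Definition box a b : set 'rV[R]_n.+1 :=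
  [set x | forall i, (a 0%R i <= x 0%R i < b 0%R i)%R].

Definition box_volume a b : R :=
  (\prod_(i < n.+1) Num.max 0 (b 0 i - a 0 i))%R.

Definition box_cover X (B : nat -> 'rV[R]_n.+1 * 'rV[R]_n.+1) :=
  X `<=` \bigcup_k box (B k).1 (B k).2.

Definition lebesgue_outer X : \bar R :=
  ereal_inf [set \sum_(k <oo) (box_volume (B k).1 (B k).2)%:E
            | B in box_cover X].

Let vol (B : 'rV[R]_n.+1 * 'rV[R]_n.+1) : \bar R := (box_volume B.1 B.2)%:E.

Let vol_ge0 B : 0 <= vol B.
Proof. by rewrite lee_fin; apply: prodr_ge0 => i _; rewrite le_max lexx. Qed.

Lemma lebesgue_outer_ge0 X : 0 <= lebesgue_outer X.
Proof.
by apply: le_ereal_inf_tmp => _ [B _ <-]; apply: nneseries_ge0 => k _ _;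
  exact: vol_ge0.
Qed.

Lemma le_lebesgue_outer :
  {homo lebesgue_outer : X Y / X `<=` Y >-> X <= Y}.
Proof.
move=> X Y XY; apply: ereal_inf_le_tmp => _ [B YB <-].
by exists B => //; exact: subset_trans YB.
Qed.

Lemma lebesgue_outer0 : lebesgue_outer set0 = 0.
Proof.
apply/eqP; rewrite eq_le lebesgue_outer_ge0 andbT.
apply: ereal_inf_lbound; exists (fun=> (0%R, 0%R)) => //.
rewrite eseries0// => k _ _.
by rewrite /box_volume big_ord_recl /= !mxE subr0 maxxx mul0r.
Qed.

Lemma lebesgue_outer_sigma_subadditive : sigma_subadditive lebesgue_outer.
Proof.
move=> A; have [[i ioo]|] := pselect (exists i, lebesgue_outer (A i) = +oo).
  rewrite (eseries_pinfty _ _ ioo) ?leey// => k _.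
  by rewrite -ltNye (lt_le_trans _ (lebesgue_outer_ge0 _)).
rewrite -forallNE => Aoo.
suff add2e (e : {posnum R}) : lebesgue_outer (\bigcup_k A k) <=
    \sum_(i <oo) lebesgue_outer (A i) + e%:num%:E.
  by apply/lee_addgt0Pr => _/posnumP[].
rewrite (le_trans _ (epsilon_trick _ _ _))//; last first.
  by move=> k; exact: lebesgue_outer_ge0.
pose P k (B : nat -> 'rV[R]_n.+1 * 'rV[R]_n.+1) := box_cover (A k) B /\
  \sum_(j <oo) vol (B j) <=
    lebesgue_outer (A k) + (e%:num / (2 ^ k.+1)%:R)%:E.
have [G PG] : {G : nat -> nat -> 'rV[R]_n.+1 * 'rV[R]_n.+1 &
    forall k, P k (G k)}.
  apply: (@choice _ _ P) => k; rewrite /P.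
  have fA : lebesgue_outer (A k) \is a fin_num.
    rewrite ge0_fin_numE ?lebesgue_outer_ge0//.
    by rewrite ltey; apply/eqP; exact: Aoo.
  have ek : (0 < e%:num / (2 ^ k.+1)%:R)%R by [].
  have [_ [B AB <-] xS] := lb_ereal_inf_adherent ek fA.
  by exists B; split => //; exact/ltW.
have volG_ge0 x : 0 <= (vol \o uncurry G) x by exact: vol_ge0.
apply: (@le_trans _ _ (\esum_(i in setT) (vol \o uncurry G) i)).
  apply: ereal_inf_lbound => /=.
  have /card_esym/ppcard_eqP[f] := card_nat2.
  exists (uncurry G \o f).
    move=> t [i _] /((PG i).1)[j _ Bijt].
    by exists (f^-1%FUN (i, j)) => //=; rewrite invK ?inE.
  rewrite -(esum_pred_image (vol \o uncurry G) _ xpredT) ?[fun=> _]set_true//.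
  by rewrite image_eq.
rewrite (_ : esum _ _ = \sum_(i <oo) \sum_(j <oo) vol (G i j)); last first.
  pose J : nat -> set (nat * nat) := fun i => [set (i, j) | j in setT].
  rewrite (_ : setT = \bigcup_k J k); last first.
    by rewrite predeqE => -[a b]; split => // _; exists a => //; exists b.
  rewrite esum_bigcupT /=; last 2 first.
    - apply/trivIsetP => i j _ _ ij.
      rewrite predeqE => -[p m] /=; split => //= -[] [_] _ [<-{p} _].
      by move=> [m' _] [] /esym/eqP; rewrite (negbTE ij).
    - by move=> /= [p m]; exact: vol_ge0.
  rewrite -(image_id [set: nat]) -fun_true esum_pred_image//; last first.
    by move=> p _; exact: esum_ge0.
  apply: eq_eseriesr => /= j _.
  rewrite -(esum_pred_image (vol \o uncurry G) (pair j) predT)//=; last first.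
    by move=> ? ? _ _; exact: (@can_inj _ _ _ snd).
  by congr esum; rewrite predeqE => -[a b]; split; move=> [i _ <-]; exists i.
apply: lee_lim.
- apply: is_cvg_nneseries => p *.
  by apply: nneseries_ge0 => m *; exact: (volG_ge0 (p, m)).
- by apply: is_cvg_nneseries => p *; apply: adde_ge0 => //;
    exact: lebesgue_outer_ge0.
- by near=> p; apply: lee_sum => i _; exact: (PG i).2.
Unshelve. all: by end_near. Qed.

HB.instance Definition _ := isOuterMeasure.Build R 'rV[R]_n.+1 lebesgue_outer
  lebesgue_outer0 lebesgue_outer_ge0 le_lebesgue_outer
  lebesgue_outer_sigma_subadditive.

End lebesgue_outer_measure.

Section lebesgue_rV.
Context {R : realType} {n : nat}.

HB.instance Definition _ := Measurable.copy 'rV[R]_n.+1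
  (caratheodory_type (@lebesgue_outer R n)).

Definition lebesgue_rV : set 'rV[R]_n.+1 -> \bar R := lebesgue_outer.

HB.instance Definition _ := isMeasure.Build _ 'rV[R]_n.+1 R lebesgue_rV
  (@caratheodory_measure0 _ _ (@lebesgue_outer R n))
  (@caratheodory_measure_ge0 _ _ (@lebesgue_outer R n))
  (@caratheodory_measure_sigma_additive _ _ (@lebesgue_outer R n)).

End lebesgue_rV.

Section euclidean.
Context {R : realType}.

Definition enorm {p q : nat} (A : 'M[R]_(p, q)) : R :=
  Num.sqrt (\sum_(i < p) \sum_(j < q) A i j ^+ 2).

Definition dot {n : nat} (x y : 'rV[R]_n) : R := \sum_(i < n) x 0 i * y 0 i.

Definition diam {n : nat} (Omega : set 'rV[R]_n) : R :=
  sup [set enorm (x - y) | x in Omega & y in Omega].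

(* Near each boundary point, in suitable orthonormal coordinates z = y *m A,
   Omega is the strict epigraph z_0 > gamma(z_1, ..., z_n) of a Lipschitz
   function gamma. *)
Definition lipschitz_boundary {n : nat} (Omega : set 'rV[R]_n.+1) : Prop :=
  forall x, (closure Omega `\` Omega°) x ->
  exists (A : 'M[R]_n.+1) (gamma : 'rV[R]_n -> R) (L r : R),
    [/\ A *m A^T = 1%:M,
        forall z z', `|gamma z - gamma z'| <= L * enorm (z - z'),
        0 < r &
        forall y, enorm (y - x) < r ->
          (Omega y <-> gamma (col' ord0 (y *m A)) < (y *m A) 0 ord0)].

End euclidean.

Section sobolev.
Context {R : realType} {n : nat}.
Local Notation mu := (@lebesgue_rV R n).
Implicit Types (Omega : set 'rV[R]_n.+1) (s : seq 'I_n.+1).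
Implicit Types (u v phi : 'rV[R]_n.+1 -> R).

Definition vol (F : set 'rV[R]_n.+1) : R := fine (mu F).

Definition average (F : set 'rV[R]_n.+1) u : R :=
  (vol F)^-1 * \int[mu]_(x in F) u x.

Definition vaverage (F : set 'rV[R]_n.+1)
    (f : 'rV[R]_n.+1 -> 'rV[R]_n.+1) : 'rV[R]_n.+1 :=
  \row_i average F (fun x => f x 0 i).

Definition center_of_mass (F : set 'rV[R]_n.+1) : 'rV[R]_n.+1 := vaverage F id.

(* The list s = [:: i1; ...; ik] encodes the differential operator
   d_i1 ... d_ik. *)
Definition partials s phi : 'rV[R]_n.+1 -> R :=
  foldr (fun i psi => 'D_(delta_mx 0 i) psi) phi s.

Definition smooth phi : Prop := forall s,
  continuous (partials s phi) /\
  forall i x, derivable (partials s phi) x (delta_mx 0 i).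

Definition test_function Omega phi : Prop :=
  let supp := closure [set x | phi x != 0] in
  [/\ smooth phi, compact supp & supp `<=` Omega].

Definition loc_integrable Omega u : Prop :=
  measurable_fun Omega u /\
  forall K, compact K -> K `<=` Omega -> mu.-integrable K (EFin \o u).

Definition is_weak_partials Omega s u v : Prop :=
  [/\ loc_integrable Omega u, loc_integrable Omega v &
      forall phi, test_function Omega phi ->
        \int[mu]_(x in Omega) (u x * partials s phi x) =
        (-1) ^+ size s * \int[mu]_(x in Omega) (v x * phi x)].

(* A representative of the weak derivative, unique up to a null set. *)
Definition weak_partials Omega s u : 'rV[R]_n.+1 -> R :=
  xget (cst 0) [set v | is_weak_partials Omega s u v].

Definition L2 Omega u : Prop :=
  measurable_fun Omega u /\
  mu.-integrable Omega (EFin \o (fun x => u x ^+ 2)).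

(* W^{k,2}(Omega); elements are given by everywhere defined representatives,
   whose values outside Omega are irrelevant. *)
Definition sobolev (k : nat) Omega u : Prop :=
  L2 Omega u /\
  forall s, (size s <= k)%N ->
    exists2 v, L2 Omega v & is_weak_partials Omega s u v.

Definition grad Omega u (x : 'rV[R]_n.+1) : 'rV[R]_n.+1 :=
  \row_i weak_partials Omega [:: i] u x.

Definition hess Omega u (x : 'rV[R]_n.+1) : 'M[R]_n.+1 :=
  \matrix_(i, j) weak_partials Omega [:: i; j] u x.

Definition L2norm Omega u : R := Num.sqrt (\int[mu]_(x in Omega) u x ^+ 2).

Definition W22norm Omega u : R :=
  Num.sqrt (\int[mu]_(x in Omega)
    (u x ^+ 2 + enorm (grad Omega u x) ^+ 2 + enorm (hess Omega u x) ^+ 2)).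

End sobolev.

(* Main.v *)
Require Import Defs.
From HB Require Import structures.
From mathcomp Require Import all_boot all_order all_algebra.
From mathcomp Require Import all_classical all_reals all_analysis.
From mathcomp Require Import measurable_realfun ring lra.

Set Implicit Arguments.
Unset Strict Implicit.
Unset Printing Implicit Defensive.

Import Order.TTheory GRing.Theory Num.Theory.
Import numFieldNormedType.Exports.

Local Open Scope classical_set_scope.
Local Open Scope ring_scope.

(* Subtract from u the affine function with gradient p = (grad u)_Omega that
   makes the remainder w have mean zero on Omega. Applying the Poincare
   inequality to each partial derivative of u and then to w gives
   ||w||_{W^{2,2}} <= (1 + Q^2 + Q^4)^{1/2} ||hess u||. The map
   l_E(v) = v_E + (grad v)_E . (x - x_E) fixes affine functions, so
   u - l_E(u) = w - l_E(w), and Jensen's inequality bounds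
   ||l_E(w)||_{W^{2,2}} by K ||w||_{W^{2,2}} with
   K^2 = 2 |Omega| / |E| (1 + diam^2).

   Weak derivatives are chosen representatives, so their almost everywhere
   uniqueness is needed: a function orthogonal to all test functions has zero
   integral over boxes (whose indicators are limits of smooth bumps built from
   exp(-1/t)), hence over Borel sets by the pi-lambda theorem, hence over
   measurable sets by outer regularity. That the weak derivatives of affine
   functions are the classical ones follows from int d_i psi = 0, obtained from
   translation invariance by differentiating int psi(x + h e_i) dx at h = 0. *)

(** * Lebesgue measure on R^n *)

Section boxes.
Context {R : realType} {n : nat}.
Local Notation mu := (@lebesgue_rV R n).
Implicit Types (a b c d x : 'rV[R]_n.+1) (X A : set 'rV[R]_n.+1).

Definition obox a b : set 'rV[R]_n.+1 :=
  [set x | forall i, a 0 i < x 0 i < b 0 i].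

Definition cbox a b : set 'rV[R]_n.+1 :=
  [set x | forall i, a 0 i <= x 0 i <= b 0 i].

Definition set_coord a (i : 'I_n.+1) (t : R) : 'rV[R]_n.+1 :=
  \row_j (if j == i then t else a 0 j).

Lemma box_volume_ge0 a b : 0 <= box_volume a b.
Proof. by apply: prodr_ge0 => i _; rewrite le_max lexx. Qed.

(** The hyperplane x_i = t cuts the box in two and changes only the i-th side length. The truncation
    at 0 in [box_volume] keeps the identity true when the hyperplane misses the box. *)
Lemma box_volume_split a b i t :
  box_volume a b = box_volume a (set_coord b i (Num.min (b 0 i) t)) +
                   box_volume (set_coord a i (Num.max (a 0 i) t)) b.
Proof.
rewrite /box_volume !(bigD1 i (P := predT))//= !mxE eqxx.
set P := (X in _ * X = _).
rewrite (_ : \prod_(_ < _ | _) _ = P); last first.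
  by apply: eq_bigr => j /negbTE ji; rewrite !mxE ji.
rewrite [X in _ = _ + _ * X](_ : _ = P); last first.
  by apply: eq_bigr => j /negbTE ji; rewrite !mxE ji.
rewrite -mulrDl; congr (_ * _).
move: (a 0 i) (b 0 i) => u v.
have [vt|tv] := leP v t; have [ut|tu] := leP u t.
- have [h1|h1] := leP 0 (v - u); have [h2|h2] := leP 0 (v - t); lra.
- have [h1|h1] := leP 0 (v - u); lra.
- have [h1|h1] := leP 0 (v - u); have [h2|h2] := leP 0 (t - u);
    have [h3|h3] := leP 0 (v - t); lra.
- have [h1|h1] := leP 0 (v - u); have [h2|h2] := leP 0 (t - u); lra.
Qed.

(** Any cover of X is cut box by box along x_i = t into covers of the two parts of X, and by
    [box_volume_split] no volume is lost. *)
Lemma caratheodory_halfspace i t :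
  (@lebesgue_outer R n).-caratheodory [set x | x 0 i < t].
Proof.
apply: le_caratheodory_measurable => X.
apply: le_ereal_inf_tmp => _ [B XB <-].
pose B1 k := ((B k).1, set_coord (B k).2 i (Num.min ((B k).2 0 i) t)).
pose B2 k := (set_coord (B k).1 i (Num.max ((B k).1 0 i) t), (B k).2).
rewrite (@eq_eseriesr _ _ (fun k => (box_volume (B1 k).1 (B1 k).2)%:E +
    (box_volume (B2 k).1 (B2 k).2)%:E)%E); last first.
  by move=> k _; rewrite -EFinD -box_volume_split.
rewrite nneseriesD; [|by move=> k _ _; rewrite lee_fin box_volume_ge0..].
apply: leeD; apply: ereal_inf_lbound.
- exists B1 => // x [Xx /= xt]; have [k _ Bx] := XB _ Xx; exists k => // j.
  have /andP[ax xb] := Bx j; rewrite /B1/= ax !mxE; case: eqP => // ji.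
  by rewrite lt_min -ji xb ji.
- exists B2 => // x [Xx /negP /= xt]; have [k _ Bx] := XB _ Xx; exists k => // j.
  have /andP[ax xb] := Bx j; rewrite /B2/= xb andbT !mxE; case: eqP => // ji.
  by rewrite ge_max -ji ax ji leNgt.
Qed.

Lemma measurable_coord (i : 'I_n.+1) (D : set 'rV[R]_n.+1) :
  measurable_fun D (fun x => x 0 i).
Proof.
apply: measurable_funTS.
apply: (measurability (@RGenInftyO.G R)); first exact: RGenInftyO.measurableE.
move=> _ [_ [t ->] <-]; rewrite setTI.
have -> : (fun x : 'rV[R]_n.+1 => x 0 i) @^-1` `]-oo, t[ = [set x | x 0 i < t].
  by apply/seteqP; split=> x /=; rewrite in_itv.
exact: caratheodory_halfspace.
Qed.

Lemma measurable_forall_coord (F : 'I_n.+1 -> set R) :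
  (forall i, measurable (F i)) ->
  measurable [set x : 'rV[R]_n.+1 | forall i, F i (x 0 i)].
Proof.
move=> mF.
rewrite (_ : [set _ | _] = \bigcap_(i in [set: 'I_n.+1])
    ((fun x : 'rV[R]_n.+1 => x 0 i) @^-1` F i)); last first.
  by apply/seteqP; split=> x /= h i; [move=> _|]; exact: h.
apply: fin_bigcap_measurable => // i _.
by rewrite -[X in measurable X]setTI; exact: measurable_coord.
Qed.

Lemma measurable_obox a b : measurable (obox a b).
Proof.
have -> : obox a b = [set x | forall i, `]a 0 i, b 0 i[%classic (x 0 i)].
  by apply/seteqP; split=> x h i; have := h i; rewrite /= in_itv.
by apply: (@measurable_forall_coord (fun i => _)) => i; exact: measurable_itv.
Qed.

Lemma measurable_box a b : measurable (box a b).
Proof.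
have -> : box a b = [set x | forall i, `[a 0 i, b 0 i[%classic (x 0 i)].
  by apply/seteqP; split=> x h i; have := h i; rewrite /= in_itv.
by apply: (@measurable_forall_coord (fun i => _)) => i; exact: measurable_itv.
Qed.

Lemma compact_cbox a b : compact (cbox a b).
Proof.
have -> : cbox a b = [set x | forall i, `[a 0 i, b 0 i]%classic (x 0 i)].
  by apply/seteqP; split=> x h i; have := h i; rewrite /= in_itv.
by apply: (@rV_compact _ _ (fun i => `[a 0 i, b 0 i]%classic)) => i; exact: segment_compact.
Qed.

Lemma lebesgue_box_le a b X : X `<=` box a b -> (mu X <= (box_volume a b)%:E)%E.
Proof.
move=> Xab; apply: ereal_inf_lbound.
(* The cover consists of the box itself followed by degenerate boxes of volume 0. *)
exists (fun k => if k is 0 then (a, b) else (0 : 'rV[R]_n.+1, 0 : 'rV[R]_n.+1)).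
  by move=> x /Xab abx; exists 0%N.
rewrite (@nneseriesD1 _ _ 0%N)//=; last first.
  by move=> k _; rewrite lee_fin; exact: box_volume_ge0.
rewrite eseries0 ?adde0// => -[|k] //= _ _.
by rewrite /box_volume big_ord_recl /= !mxE subr0 maxxx mul0r.
Qed.

Lemma ltr_norm_coord x (M : R) i : `|x| < M -> `|x 0 i| < M.
Proof.
move=> xM; have : ball (0 : 'rV[R]_n.+1) M x.
  by rewrite mx_norm_ball /ball_/= sub0r normrN.
by case=> _ /(_ 0 i); rewrite /ball/= mxE sub0r normrN.
Qed.

Lemma bounded_sub_obox X : bounded_set X ->
  exists2 M : R, 0 < M & X `<=` obox (const_mx (- M)) (const_mx M).
Proof.
move=> [M [_ XM]]; exists (`|M| + 2); first by have := normr_ge0 M; lra.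
move=> x Xx i; rewrite !mxE -ltr_norml; apply: ltr_norm_coord.
have := XM (`|M| + 1) _ x Xx; have := ler_norm M => MM.
by rewrite /= => /(_ _); have h : M < `|M| + 1 by [lra|]; move=> /(_ h); lra.
Qed.

Lemma obox_sub_box a b : obox a b `<=` box a b.
Proof. by move=> x h i; have /andP[/ltW -> ->] := h i. Qed.

Lemma bounded_lebesgue_fin X : bounded_set X -> (mu X < +oo)%E.
Proof.
move=> /bounded_sub_obox[M _ XM]; apply: le_lt_trans (ltry (box_volume (const_mx (- M)) (const_mx M))).
exact/lebesgue_box_le/(subset_trans XM)/obox_sub_box.
Qed.

(** Boxes with rational corners suffice. Their closures are kept inside U so that bump functions on
    them have compact support in U. *)
Lemma open_bigcup_obox (U : set 'rV[R]_n.+1) : open U ->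
  exists a b : nat -> 'rV[R]_n.+1,
    (forall k, cbox (a k) (b k) `<=` U) /\
    U = \bigcup_k obox (a k) (b k).
Proof.
move=> oU.
(* Codes that decode to no pair of corners, or to a closed box leaving U, are sent to the corners 1
   and 0, between which there is no point. *)
pose ab (k : nat) : 'rV[R]_n.+1 * 'rV[R]_n.+1 :=
  if @unpickle ('rV[rat]_n.+1 * 'rV[rat]_n.+1)%type k is Some q then
    if pselect (cbox (map_mx ratr q.1) (map_mx ratr q.2) `<=` U) then
      (map_mx ratr q.1, map_mx ratr q.2) else (const_mx 1, 0)
  else (const_mx 1, 0).
have cbox0 : cbox (const_mx 1) 0 = set0.
  by apply/seteqP; split=> x //= /(_ ord0); rewrite !mxE => /andP[]; lra.
have sub k : cbox (ab k).1 (ab k).2 `<=` U.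
  rewrite /ab; case: unpickle => [q|]; last by rewrite cbox0.
  by case: pselect => // h; rewrite cbox0.
exists (fun k => (ab k).1), (fun k => (ab k).2); split => //.
apply/seteqP; split; last first.
  by move=> x [k _ kx]; apply: (sub k) => i; have /andP[/ltW -> /ltW ->] := kx i.
move=> x Ux; have /nbhs_ballP[e /= e0 xeU] : nbhs x U by exact: open_nbhs_nbhs.
have [q1 q1P] : exists q : 'rV[rat]_n.+1, forall i,
    x 0 i - e < ratr (q 0 i) < x 0 i.
  have h (i : 'I_n.+1) : exists q : rat, x 0 i - e < ratr q < x 0 i.
    have [|q] := @rat_in_itvoo _ (x 0 i - e) (x 0 i); first lra.
    by rewrite in_itv => ?; exists q.
  have [f fP] := choice h.
  by exists (\row_i f i) => i; rewrite mxE.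
have [q2 q2P] : exists q : 'rV[rat]_n.+1, forall i,
    x 0 i < ratr (q 0 i) < x 0 i + e.
  have h (i : 'I_n.+1) : exists q : rat, x 0 i < ratr q < x 0 i + e.
    have [|q] := @rat_in_itvoo _ (x 0 i) (x 0 i + e); first lra.
    by rewrite in_itv => ?; exists q.
  have [f fP] := choice h.
  by exists (\row_i f i) => i; rewrite mxE.
exists (pickle (q1, q2)) => //; rewrite /ab pickleK/=.
case: pselect => [h i|[]].
  by rewrite !mxE; have /andP[_ ->] := q1P i; have /andP[-> _] := q2P i.
move=> y /= yq; apply: xeU; split => // i j; rewrite ord1 /ball/=.
have := yq j; rewrite !mxE => /andP[? ?].
have /andP[? ?] := q1P j; have /andP[? ?] := q2P j.
by rewrite ltr_norml; apply/andP; split; lra.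
Qed.

Lemma open_measurable_rV (U : set 'rV[R]_n.+1) : open U -> measurable U.
Proof.
move=> /open_bigcup_obox[a [b [_ ->]]].
by apply: bigcupT_measurable => k; exact: measurable_obox.
Qed.

Lemma closed_measurable_rV (U : set 'rV[R]_n.+1) : closed U -> measurable U.
Proof.
by rewrite -openC => /open_measurable_rV/measurableC; rewrite setCK.
Qed.

Lemma compact_measurable_rV (K : set 'rV[R]_n.+1) : compact K -> measurable K.
Proof. by move/(compact_closed (@norm_hausdorff _ _))/closed_measurable_rV. Qed.

Lemma continuous_measurable_rV (f : 'rV[R]_n.+1 -> R) (D : set 'rV[R]_n.+1) :
  continuous f -> measurable_fun D f.
Proof.
move=> /continuousP cf; apply: measurable_funTS.
apply: (measurability (@RGenOpens.G R)); first exact: RGenOpens.measurableE.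
move=> _ [_ [x [y ->]] <-]; rewrite setTI.
by apply: open_measurable_rV; apply: cf; exact: interval_open.
Qed.

Lemma continuous_compact_integrable (f : 'rV[R]_n.+1 -> R) K :
  continuous f -> compact K -> mu.-integrable K (EFin \o f).
Proof.
move=> cf cK.
apply: measurable_bounded_integrable => //.
- exact: compact_measurable_rV.
- exact/bounded_lebesgue_fin/compact_bounded.
- exact: continuous_measurable_rV.
- have /compact_bounded[M [Mr fM]] := continuous_compact (continuous_subspaceT cf) cK.
  exists M; split => // z Mz x Kx; apply: fM => //; by exists x.
Qed.

End boxes.

(** * Translation invariance of Lebesgue measure *)

Section translation.
Context {R : realType} {n : nat}.
Local Notation mu := (@lebesgue_rV R n).

Lemma box_volume_shift (h a b : 'rV[R]_n.+1) :
  box_volume (a - h) (b - h) = box_volume a b.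
Proof.
apply: eq_bigr => i _; rewrite !mxE; congr Num.max.
by ring.
Qed.

Lemma lebesgue_outer_shift_le (h : 'rV[R]_n.+1) (X : set 'rV[R]_n.+1) :
  (lebesgue_outer ([set x | X (x + h)%R]) <= lebesgue_outer X)%E.
Proof.
apply: le_ereal_inf_tmp => _ [B XB <-]; apply: ereal_inf_lbound.
exists (fun k => ((B k).1 - h, (B k).2 - h)).
  move=> x /= /XB[k _ kx]; exists k => // i /=.
  by have := kx i; rewrite !mxE lerBlDr ltrBrDr.
by apply: eq_eseriesr => k _; rewrite box_volume_shift.
Qed.

Lemma lebesgue_outer_shift (h : 'rV[R]_n.+1) (X : set 'rV[R]_n.+1) :
  lebesgue_outer ([set x | X (x + h)]) = lebesgue_outer X.
Proof.
apply/eqP; rewrite eq_le lebesgue_outer_shift_le/=.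
rewrite [leLHS](_ : _ = lebesgue_outer [set x | [set x | X (x + h)] (x + - h)]).
  exact: lebesgue_outer_shift_le.
by congr lebesgue_outer; apply/seteqP; split => x /=; rewrite addrNK.
Qed.

(** Splitting X by a translate of A amounts to splitting a translate of X by A, and the outer
    measure ignores translations. *)
Lemma measurable_shift_rV (h : 'rV[R]_n.+1) :
  measurable_fun [set: 'rV[R]_n.+1] (fun x : 'rV[R]_n.+1 => x + h).
Proof.
move=> _ A mA; rewrite setTI; change ((@lebesgue_outer R n).-caratheodory [set x | A (x + h)]) => X.
rewrite -[LHS](lebesgue_outer_shift (- h)) (mA [set x | X (x - h)]).
congr (_ + _)%E; rewrite -[RHS](lebesgue_outer_shift (- h)); congr lebesgue_outer;
  by apply/seteqP; split => x /=; rewrite addrNK.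
Qed.

(** Change of variables: the pushforward of [mu] under a translation is [mu] again. *)
Lemma integral_shift (h : 'rV[R]_n.+1) (f : 'rV[R]_n.+1 -> R) :
  measurable_fun setT f ->
  mu.-integrable setT (EFin \o f) ->
  mu.-integrable setT (fun x => (f (x + h)%R)%:E) ->
  (\int[mu]_x (f (x + h)%R)%:E = \int[mu]_x (f x)%:E)%E.
Proof.
move=> mf fi fhi.
have := @integral_pushforward _ _ _ _ R _ (measurable_shift_rV h) mu setT (EFin \o f).
rewrite preimage_setT => /(_ _ fhi measurableT) <-; last exact/measurable_EFinP.
apply: eq_measure_integral.
  exact: measurable_shift_rV.
by move=> m A mA _; exact: lebesgue_outer_shift.
Qed.


End translation.

(** * Smooth bump functions *)

Section flat_functions.
Context {R : realType}.
Implicit Types (p : {poly R}) (t : R).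

(** The polynomial factor in 1/t makes the family stable under differentiation; [flat 1] is the
    classical smooth function exp(-1/t) extended by 0. *)
Definition flat p t : R := if 0 < t then p.[t^-1] * expR (- t^-1) else 0.

Lemma flat_pos p t : 0 < t -> flat p t = p.[t^-1] * expR (- t^-1).
Proof. by rewrite /flat => ->. Qed.

Lemma flat_neg p t : t <= 0 -> flat p t = 0.
Proof. by rewrite /flat ltNge => ->. Qed.

(** With s = 1/t, the bound exp(s) >= s^(i+1) / (i+1)! shows that each monomial satisfies s^i
    exp(-s) <= (i+1)! t. *)
Lemma flat_le p : exists C, forall t, `|flat p t| <= C * `|t|.
Proof.
exists (\sum_(i < size p) `|p`_i| * (i.+1)`!%:R) => t.
have [t0|t0] := ltP 0 t; last first.
  rewrite flat_neg// normr0 mulr_ge0//.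
  by apply: sumr_ge0 => i _; rewrite mulr_ge0.
rewrite flat_pos// normrM [X in _ * X]ger0_norm ?expR_ge0// [X in _ <= _ * X]gtr0_norm//.
rewrite horner_coef mulr_suml.
apply: (@le_trans _ _ ((\sum_(i < size p) `|p`_i| * t^-1 ^+ i) * expR (- t^-1))).
  rewrite ler_wpM2r ?expR_ge0// (le_trans (ler_norm_sum _ _ _))//.
  apply: ler_sum => i _.
  by rewrite normrM normrX (@ger0_norm _ t^-1)// invr_ge0 ltW.
rewrite mulr_suml; apply: ler_sum => i _; rewrite -!mulrA ler_wpM2l//.
rewrite expRN ler_pdivrMr ?expR_gt0// -ler_pdivrMl; last first.
  by rewrite mulr_gt0// ltr0n fact_gt0.
apply: le_trans (expR_ge1Dxn i _); last by rewrite invr_ge0 ltW.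
rewrite -[leLHS]add0r lerD// exprSr invfM mulrC mulrAC mulrA.
by [].
Qed.

Lemma flat_cvg0 p : flat p t @[t --> 0] --> 0.
Proof.
have [C Cp] := flat_le p.
apply/cvgr0Pnorm_le => e e0; near=> t.
apply: le_trans (Cp t) _.
apply: (@le_trans _ _ ((`|C| + 1) * `|t|)).
  by rewrite ler_wpM2r// (le_trans (ler_norm _))// lerDl.
rewrite -ler_pdivlMl; last by rewrite ltr_wpDl.
near: t; apply: cvgr0_norm_le; first exact: cvg_id.
by rewrite mulr_gt0 ?invr_gt0 ?ltr_wpDl.
Unshelve. all: by end_near. Qed.

(** Away from 0 this is the chain rule. At 0 the difference quotient of [flat p] is [flat ('X * p)],
    which tends to 0. *)
Lemma is_derive_flat p t :
  is_derive t 1 (flat p) (flat ('X^2 * (p - p^`())) t).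
Proof.
have [t0|t0|->] := ltgtP t 0.
- rewrite flat_neg ?ltW//.
  apply: (near_eq_is_derive (f := cst (0 : R))).
  near=> s; rewrite /cst flat_neg// ltW//; near: s; exact: lt_nbhsl.
- apply: (near_eq_is_derive (f := (fun s : R => p.[s^-1] * expR (- s^-1)))).
    by near=> s; rewrite flat_pos//; near: s; exact: lt_nbhsr.
  have dV : is_derive t 1 (fun s : R => s^-1) (- t ^- 2 *: 1).
    by apply: (@is_deriveV _ id t 1 1) => //; rewrite gt_eqF.
  have d1 := is_derive1_comp (is_derive_poly p t^-1) dV.
  have dNV : is_derive t 1 (fun s : R => - s^-1) (- (- t ^- 2 *: 1)).
    exact: is_deriveN.
  have d2 := @is_derive1_comp _ expR (fun s : R => - s^-1) t _ _
    (is_derive_expR (- t^-1)) dNV.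
  have := is_deriveM d1 d2.
  rewrite flat_pos// => h; apply: (is_derive_eq h).
  rewrite !hornerE /= /GRing.scale/= exprVn.
  by field; rewrite gt_eqF.
- rewrite flat_neg//.
  have h : h^-1 *: ((flat p \o shift (0 : R)) (h *: 1) - flat p 0) @[h --> (0 : R)^'] --> (0 : R).
    apply: (@cvg_trans _ ((flat ('X * p) s @[s --> (0:R)^']) : set_system R)); last first.
      exact: cvg_trans (cvg_app _ (@nbhs_dnbhs _ _)) (flat_cvg0 _).
    apply: near_eq_cvg; near=> s => /=.
    rewrite /GRing.scale/= mulr1 addr0 (flat_neg _ (lexx 0)) subr0.
    have [s0|s0] := ltP 0 s.
      by rewrite !flat_pos// hornerM hornerX mulrA.
    by rewrite !flat_neg// mulr0.
  apply: DeriveDef; first by apply/cvg_ex; exists 0.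
  exact: cvg_lim h.
Unshelve. all: by end_near. Qed.

Lemma continuous_flat p : continuous (flat p).
Proof.
move=> t; apply: differentiable_continuous; apply/derivable1_diffP.
by have [] := is_derive_flat p t.
Qed.

End flat_functions.

(** Both sides have the same difference quotient. This reduces directional derivatives to one real
    variable, for the chain rule and the mean value theorem. *)
Lemma is_derive_line {R : realType} {V : normedModType R} (f : V -> R)
    (v x : V) (t l : R) :
  is_derive t 1 (fun h : R => f (h *: v + x)) l <->
  is_derive (t *: v + x) v f l.
Proof.
have E : (fun h : R => h^-1 *: (((fun h : R => f (h *: v + x)) \o shift t) (h *: 1) -
      (fun h : R => f (h *: v + x)) t)) =
    (fun h : R => h^-1 *: ((f \o shift (t *: v + x)) (h *: v) - f (t *: v + x))).
  apply/funext => h /=; congr (_ *: (f _ - _)).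
  have -> : h *: (1 : R) = h by exact: mulr1.
  by rewrite scalerDl addrA.
split=> -[d1 d2].
- by apply: DeriveDef; [move: d1; rewrite /derivable E|move: d2; rewrite /derive E].
- by apply: DeriveDef; [move: d1; rewrite /derivable -E|move: d2; rewrite /derive -E].
Qed.

Section smooth_functions.
Context {R : realType} {n : nat}.
Implicit Types (f g phi : 'rV[R]_n.+1 -> R) (a b : 'rV[R]_n.+1).

(* The algebra generated by the functions [flat p] of affine functions of one
   coordinate is stable under partial derivatives. *)
Inductive flat_algebra : ('rV[R]_n.+1 -> R) -> Prop :=
| flat_algebra_cst (c : R) : flat_algebra (fun=> c)
| flat_algebra_flat p i (c d : R) :
    flat_algebra (fun x => flat p (c * x 0 i + d))
| flat_algebra_add f g :
    flat_algebra f -> flat_algebra g -> flat_algebra (fun x => f x + g x)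
| flat_algebra_mul f g :
    flat_algebra f -> flat_algebra g -> flat_algebra (fun x => f x * g x).

Lemma flat_algebra_continuous f : flat_algebra f -> continuous f.
Proof.
elim=> {f} [c|p i c d|f g _ cf _ cg|f g _ cf _ cg] x.
- exact: cst_continuous.
- apply: (@continuous_comp _ _ _ (fun x : 'rV[R]_n.+1 => c * x 0 i + d) (flat p)).
    apply: continuousD; last exact: cst_continuous.
    by apply: continuousM; [exact: cst_continuous|exact: coord_continuous].
  exact: continuous_flat.
- by apply: continuousD; [exact: cf|exact: cg].
- by apply: continuousM; [exact: cf|exact: cg].
Qed.

Lemma flat_algebra_derive f j : flat_algebra f ->
  exists2 df, flat_algebra df & forall x, is_derive x (delta_mx 0 j) f (df x).
Proof.
elim=> {f} [c|p i c d|f g hf [df hdf fdf] hg [dg hdg gdg]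
                     |f g hf [df hdf fdf] hg [dg hdg gdg]].
- by exists (fun=> 0) => [|x]; [exact: flat_algebra_cst|exact: is_derive_cst].
- exists (fun x => (c * (i == j)%:R) * flat ('X^2 * (p - p^`())) (c * x 0 i + d)).
    by apply: flat_algebra_mul; [exact: flat_algebra_cst|exact: flat_algebra_flat].
  move=> x; have {1}-> : x = 0 *: delta_mx 0 j + x by rewrite scale0r add0r.
  apply/is_derive_line.
  have -> : (fun h : R => flat p (c * (h *: delta_mx 0 j + x) 0 i + d)) =
      flat p \o (fun h : R => (c * (i == j)%:R) * h + (c * x 0 i + d)).
    by apply/funext => h /=; rewrite !mxE eqxx/=; congr flat; ring.
  rewrite [X in is_derive _ _ _ X]mulrC; apply: is_derive1_comp.
    rewrite mulr0 add0r; exact: is_derive_flat.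
  have h1 : is_derive (0 : R) 1 (fun h : R => c * (i == j)%:R * h) (c * (i == j)%:R *: 1).
    exact: (@is_deriveZ _ _ _ (@id R) (c * (i == j)%:R) 0 1 1).
  rewrite [X in is_derive _ _ _ X](_ : _ = c * (i == j)%:R *: 1 + 0); last first.
    by rewrite addr0 /GRing.scale/= mulr1.
  exact: is_deriveD.
- exists (fun x => df x + dg x); first exact: flat_algebra_add.
  by move=> x; exact: is_deriveD.
- exists (fun x => f x * dg x + g x * df x).
    by apply: flat_algebra_add; exact: flat_algebra_mul.
  by move=> x; exact: is_deriveM.
Qed.

Lemma flat_algebra_partials f s : flat_algebra f -> flat_algebra (partials s f).
Proof.
move=> hf; elim: s => //= i s ih.
have [df hdf fdf] := flat_algebra_derive i ih.
rewrite (_ : (fun _ => _) = df)//; apply/funext => x.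
by have [] := fdf x.
Qed.

Lemma flat_algebra_smooth f : flat_algebra f -> smooth f.
Proof.
move=> hf s; have hsf := flat_algebra_partials s hf.
split; first exact: flat_algebra_continuous.
move=> i x; have [df _ fdf] := flat_algebra_derive i hsf.
by have [] := fdf x.
Qed.

Lemma flat_algebra_prod (I : Type) (r : seq I) (F : I -> 'rV[R]_n.+1 -> R) :
  (forall i, flat_algebra (F i)) -> flat_algebra (fun x => \prod_(i <- r) F i x).
Proof.
move=> hF; elim: r => [|i r ih].
  rewrite (_ : (fun x => _) = fun=> 1); first exact: flat_algebra_cst.
  by apply/funext => x; rewrite big_nil.
rewrite (_ : (fun x => _) = fun x => F i x * \prod_(j <- r) F j x).
  exact: flat_algebra_mul.
by apply/funext => x; rewrite big_cons.
Qed.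

(** The arguments are (k+1)(x_i - a_i) and (k+1)(b_i - x_i), expanded to match [flat_algebra_flat].
    Inside the open box the scaling drives every factor to 1; outside, some factor is 0. *)
Definition bump a b (k : nat) : 'rV[R]_n.+1 -> R := fun x =>
  \prod_(i < n.+1) (flat 1 (k.+1%:R * x 0 i + - (k.+1%:R * a 0 i)) *
                    flat 1 (- k.+1%:R * x 0 i + k.+1%:R * b 0 i)).

Lemma bump_flat_algebra a b k : flat_algebra (bump a b k).
Proof.
by apply: flat_algebra_prod => i; apply: flat_algebra_mul; exact: flat_algebra_flat.
Qed.

Lemma flat1_itv (t : R) : 0 <= flat 1 t <= 1.
Proof.
have [t0|t0] := ltP 0 t; last by rewrite flat_neg// lexx ler01.
rewrite flat_pos// hornerC mul1r expR_ge0/=.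
by rewrite -[leRHS]expR0 ler_expR oppr_le0 invr_ge0 ltW.
Qed.

Lemma bump_itv a b k x : 0 <= bump a b k x <= 1.
Proof.
suff h i : 0 <= flat 1 (k.+1%:R * x 0 i + - (k.+1%:R * a 0 i)) *
                flat 1 (- k.+1%:R * x 0 i + k.+1%:R * b 0 i) <= 1.
  rewrite prodr_ge0 ?prodr_ile1//; by move=> i _; have /andP[] := h i.
have /andP[h1 h2] := flat1_itv (k.+1%:R * x 0 i + - (k.+1%:R * a 0 i)).
have /andP[h3 h4] := flat1_itv (- k.+1%:R * x 0 i + k.+1%:R * b 0 i).
by rewrite mulr_ge0//= mulr_ile1.
Qed.

Lemma bump_out a b k x : ~ obox a b x -> bump a b k x = 0.
Proof.
move=> /existsNP[i /negP]; rewrite negb_and -!leNgt => h.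
rewrite /bump (bigD1 i)//=; case/orP: h => h.
  by rewrite flat_neg ?mul0r// -mulrBr mulr_ge0_le0// subr_le0.
by rewrite [X in _ * X * _]flat_neg ?mulr0 ?mul0r// mulNr addrC -mulrBr mulr_ge0_le0// subr_le0.
Qed.

Lemma cvg_flat1 (c : R) : 0 < c -> flat 1 (k.+1%:R * c) @[k --> \oo] --> (1 : R).
Proof.
move=> c0.
rewrite (_ : (fun k => _) = fun k : nat => expR (- (k.+1%:R^-1 * c^-1))); last first.
  apply/funext => k; rewrite flat_pos ?mulr_gt0//.
  by rewrite hornerC mul1r invfM.
rewrite -[X in _ --> X]expR0; apply: continuous_cvg; first exact: continuous_expR.
rewrite -[X in _ --> X]oppr0; apply: cvgN.
rewrite -[X in _ --> X](mul0r c^-1); apply: cvgM; last exact: cvg_cst.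
exact: cvg_harmonic.
Qed.

Lemma bump_cvg a b x : bump a b k x @[k --> \oo] --> (\1_(obox a b) x : R).
Proof.
rewrite indicE; case: (boolP (x \in obox a b)) => [/set_mem h|/negP h]; last first.
  rewrite (_ : (fun k => _) = fun=> 0); first exact: cvg_cst.
  by apply/funext => k; rewrite bump_out// => h'; apply: h; exact/mem_set.
rewrite /bump [X in _ --> X](_ : _ = \prod_(i < n.+1) (1 * 1 : R)); last first.
  by rewrite big1// => i _; rewrite mulr1.
apply: cvg_big => [|i _]; first exact: mul_continuous.
have /andP[ax xb] := h i.
apply: cvgM.
  under eq_fun do rewrite -mulrBr.
  by apply: cvg_flat1; rewrite subr_gt0.
under eq_fun do rewrite mulNr addrC -mulrBr.
by apply: cvg_flat1; rewrite subr_gt0.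
Qed.

Lemma closed_cbox a b : closed (cbox a b).
Proof. by apply: compact_closed; [exact: norm_hausdorff|exact: compact_cbox]. Qed.

Lemma obox_sub_cbox a b : obox a b `<=` cbox a b.
Proof. by move=> x h i; have /andP[/ltW -> /ltW ->] := h i. Qed.

Lemma bump_test_function (Omega : set 'rV[R]_n.+1) a b k :
  cbox a b `<=` Omega -> test_function Omega (bump a b k).
Proof.
move=> abO.
have sub : closure [set x | bump a b k x != 0] `<=` cbox a b.
  rewrite [X in _ `<=` X](closure_id (cbox a b)).1; last exact: closed_cbox.
  apply: closure_subset.
  move=> x /= h; apply: obox_sub_cbox; apply: contrapT => /bump_out h'.
  by rewrite h' eqxx in h.
split.
- exact/flat_algebra_smooth/bump_flat_algebra.
- by apply: subclosed_compact sub; [exact: closed_closure|exact: compact_cbox].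
- exact: subset_trans abO.
Qed.

End smooth_functions.

(** * The fundamental lemma of the calculus of variations *)

Section integral_zero_sets.
Context {d : measure_display} {T : measurableType d} {R : realType}.
Variable mu : {measure set T -> \bar R}.
Local Open Scope ereal_scope.

(** The measurable sets over which f integrates to 0 form a lambda-system: proper differences follow
    from additivity, and increasing unions from splitting them into disjoint differences. *)
Lemma integral0_sigma_algebra (G : set (set T)) (f : T -> \bar R) :
  setI_closed G -> G `<=` measurable -> mu.-integrable setT f ->
  \int[mu]_x f x = 0 -> (forall A, G A -> \int[mu]_(x in A) f x = 0) ->
  forall A, <<s G >> A -> \int[mu]_(x in A) f x = 0.
Proof.
move=> GI Gm fi f0 Gf A GA.
pose H := [set A | measurable A /\ \int[mu]_(x in A) f x = 0].
have mf : measurable_fun setT f by exact: measurable_int fi.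
have fiS B : measurable B -> mu.-integrable B f.
  by move=> mB; exact: integrableS fi.
suff : <<s G >> `<=` H by move=> /(_ _ GA)[].
apply: (@lambda_system_subset _ G GI setT H) => //; last first.
  by move=> B GB; split; [exact: Gm|exact: Gf].
have HD B C : C `<=` B -> H B -> H C -> H (B `\` C).
  move=> CB [mB fB] [mC fC]; have mBC : measurable (B `\` C) by exact: measurableD.
  split => //; move: fB; rewrite -{1}(setDUK CB) integral_setU//.
  - by rewrite fC add0e.
  - exact: measurable_funTS.
  - by apply/disj_setPS => x [Cx []].
split => // F ndF HF; split.
  by apply: bigcupT_measurable => k; have [] := HF k.
have mD k : H (seqD F k).
  case: k => [|k]; first exact: HF.
  by apply: HD; [exact/subsetPset/ndF|exact: HF|exact: HF].
rewrite -eq_bigcup_seqD integral_bigcup.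
- by rewrite eseries0// => k _ _; have [] := mD k.
- exact: trivIset_seqD.
- by move=> k; have [] := mD k.
- by apply: fiS; apply: bigcupT_measurable => k; have [] := mD k.
Qed.

End integral_zero_sets.

Section fundamental_lemma.
Context {R : realType} {n : nat}.
Local Notation mu := (@lebesgue_rV R n).
Implicit Types (a b x : 'rV[R]_n.+1) (f w phi : 'rV[R]_n.+1 -> R).
Implicit Types (Omega A : set 'rV[R]_n.+1).

Definition oboxes : set (set 'rV[R]_n.+1) :=
  [set A | exists a b, A = obox a b].

Lemma obox_setI a b a' b' : obox a b `&` obox a' b' =
  obox (\row_i Num.max (a 0 i) (a' 0 i)) (\row_i Num.min (b 0 i) (b' 0 i)).
Proof.
apply/seteqP; split => x.
  by move=> [h h'] i; rewrite !mxE gt_max lt_min; have /andP[-> ->] := h i;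
    have /andP[-> ->] := h' i.
by move=> h; split=> i; have := h i; rewrite !mxE gt_max lt_min =>
  /andP[/andP[? ?] /andP[? ?]]; apply/andP.
Qed.

Lemma oboxes_setI : setI_closed oboxes.
Proof.
by move=> _ _ [a [b ->]] [a' [b' ->]]; rewrite obox_setI; do 2 eexists.
Qed.

(** Half-open boxes are the ones that define the outer measure. Lowering the left corner by 1/(k+1)
    exhibits such a box as a countable intersection of open ones. *)
Lemma oboxes_box a b : <<s oboxes >> (box a b).
Proof.
rewrite (_ : box a b = \bigcap_k obox (a - const_mx k.+1%:R^-1) b).
  apply: (@bigcapT_measurable _ (g_sigma_algebraType oboxes)) => k.
  by apply: sub_sigma_algebra; exists (a - const_mx k.+1%:R^-1), b.
apply/seteqP; split => x h.
  move=> k _ i; have /andP[ax ->] := h i; rewrite !mxE andbT.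
  by rewrite ltrBlDr (le_lt_trans ax)// ltrDl invr_gt0.
move=> i; have /andP[_ ->] := h 0%N Logic.I i; rewrite andbT.
apply/ler_addgt0Pr => e e0.
have [k ke] : exists k : nat, k.+1%:R^-1 < e.
  exists (Num.truncn e^-1); rewrite invf_plt ?posrE//.
  exact: truncnS_gt.
have /andP[+ _] := h k Logic.I i; rewrite !mxE ltrBlDr => /ltW/le_trans; apply.
by rewrite lerD2l ltW.
Qed.

(* Outer regularity: up to a null set, a measurable set of finite measure is a
   countable intersection of countable unions of boxes. *)
Lemma integral0_measurable (f : 'rV[R]_n.+1 -> \bar R) :
  mu.-integrable setT f ->
  (forall A, <<s oboxes >> A -> \int[mu]_(x in A) f x = 0)%E ->
  forall P, measurable P -> (mu P < +oo)%E -> (\int[mu]_(x in P) f x = 0)%E.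
Proof.
move=> fi f0 P mP Poo.
have Pfin : mu P \is a fin_num by rewrite ge0_fin_numE.
have mf := measurable_int _ fi.
have [G [mG GG PG GP]] : exists G : set 'rV[R]_n.+1,
    [/\ measurable G, <<s oboxes >> G, P `<=` G & (mu G <= mu P)%E].
  have cov (k : nat) : exists B, box_cover P B /\
      (\sum_(j <oo) (box_volume (B j).1 (B j).2)%:E <= mu P + k.+1%:R^-1%:E)%E.
    have k0 : 0 < k.+1%:R^-1 :> R by rewrite invr_gt0.
    have [_ [B PB <-] /ltW h] := lb_ereal_inf_adherent k0 Pfin.
    by exists B.
  have [B BP] := choice cov.
  pose G k := \bigcup_j box (B k j).1 (B k j).2.
  exists (\bigcap_k G k); split.
  - apply: bigcapT_measurable => k; apply: bigcupT_measurable => j; exact: measurable_box.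
  - apply: (@bigcapT_measurable _ (g_sigma_algebraType oboxes)) => k.
    apply: (@bigcupT_measurable _ (g_sigma_algebraType oboxes)) => j; exact: oboxes_box.
  - by move=> x Px k _; have [+ _] := BP k; apply.
  - apply/lee_addgt0Pr => e e0.
    have [k ke] : exists k : nat, k.+1%:R^-1 < e.
      exists (Num.truncn e^-1); rewrite invf_plt ?posrE//.
      exact: truncnS_gt.
    apply: (@le_trans _ _ (mu P + k.+1%:R^-1%:E)%E); last first.
      by rewrite leeD2l// lee_fin ltW.
    have [_] := BP k; apply: le_trans.
    apply: (@le_trans _ _ (mu (G k))); first exact: le_lebesgue_outer (bigcap_inf _).
    by apply: ereal_inf_lbound; exists (B k) => //; exact: subset_refl.
have GP0 : mu (G `\` P) = 0%E.
  rewrite measureD//=; last by rewrite (le_lt_trans GP)// -ge0_fin_numE.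
  rewrite (setIidr PG); apply/eqP; rewrite eq_le sube_ge0 ?Pfin ?orbT//.
  by rewrite leeBlDr// add0e GP le_measure ?inE.
(* The integral over G is 0 and splits into those over P and over the null set G \ P. *)
have := f0 _ GG; rewrite -{1}(setDUK PG) integral_setU//.
- rewrite [X in (_ + X)%E](null_set_integral (N := G `\` P))//.
  + by rewrite adde0.
  + exact: measurableD.
  + exact: measurable_funTS.
- exact: measurableD.
- exact: measurable_funTS.
- by apply/disj_setPS => x [Px []].
Qed.

Lemma smooth_D phi i : smooth phi -> smooth ('D_(delta_mx 0 i) phi).
Proof.
move=> sp s; have := sp (rcons s i); rewrite /partials foldr_rcons.
exact.
Qed.

Lemma derive_out_supp phi v x : ~ closure [set x | phi x != 0] x ->
  'D_v phi x = 0.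
Proof.
move=> h; rewrite (near_eq_derive (g := cst 0)) ?derive_cst//.
have : nbhs x (~` closure [set x | phi x != 0]).
  by apply: open_nbhs_nbhs; split => //; exact/closed_openC/closed_closure.
apply: filterS => y hy /=; apply/eqP; apply: contrapT => /negP hy'; apply: hy.
exact: subset_closure.
Qed.

Lemma test_function_D Omega phi i : test_function Omega phi ->
  test_function Omega ('D_(delta_mx 0 i) phi).
Proof.
move=> [sp cp pO].
have sub : closure [set x | 'D_(delta_mx 0 i) phi x != 0] `<=`
    closure [set x | phi x != 0].
  rewrite [X in _ `<=` X](closure_id (closure _)).1; last exact: closed_closure.
  apply: closure_subset => x /= h; apply: contrapT => /derive_out_supp h'.
  by rewrite h' eqxx in h.
split; first exact: smooth_D.
- exact: subclosed_compact (@closed_closure _ _) cp sub.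
- exact: subset_trans pO.
Qed.

Lemma test_function_partials Omega phi s : test_function Omega phi ->
  test_function Omega (partials s phi).
Proof. by move=> tp; elim: s => //= i s; exact: test_function_D. Qed.

Lemma test_function_continuous Omega phi : test_function Omega phi -> continuous phi.
Proof. by move=> [/(_ [::])[]]. Qed.

Lemma test_function_bounded Omega phi : test_function Omega phi ->
  exists2 M, 0 <= M & forall x, `|phi x| <= M.
Proof.
move=> tp; have cp := test_function_continuous tp; have [_ cK _] := tp.
have /compact_bounded[M [Mr fM]] := continuous_compact (continuous_subspaceT cp) cK.
exists (`|M| + 1) => [|x]; first by rewrite addr_ge0.
have [->|x0] := eqVneq (phi x) 0; first by rewrite normr0 addr_ge0.
apply: fM; last by exists x => //; exact: subset_closure.
by rewrite (le_lt_trans (ler_norm _))// ltrDl.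
Qed.

(** If M bounds |phi| and K is the support of phi, the product is dominated by M w cut off to K,
    which is integrable because K is compact. *)
Lemma loc_integrable_mul_test Omega w phi : open Omega ->
  loc_integrable Omega w -> test_function Omega phi ->
  mu.-integrable Omega (EFin \o (fun x => w x * phi x)).
Proof.
move=> oO [mw wi] tp; have [sp cK KO] := tp.
set K := closure _ in cK KO.
have mO := open_measurable_rV oO; have mK := compact_measurable_rV cK.
have [M M0 pM] := test_function_bounded tp.
have iK : mu.-integrable K (fun x => (M * w x)%:E).
  by have := integrableZl mK M (wi _ cK KO); apply: eq_integrable.
have iO : mu.-integrable Omega ((fun x => (M * w x)%:E) \_ K).
  by apply/integrable_restrict => //; rewrite setIidr.
apply: le_integrable iO => //.
  apply/measurable_EFinP; apply: measurable_funM => //.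
  exact/continuous_measurable_rV/(test_function_continuous tp).
move=> x Ox; rewrite patchE; case: ifPn => [|xK].
  by move=> _; rewrite lee_fin !normrM mulrC ler_wpM2r// (le_trans (pM x))// ger0_norm.
rewrite /= (_ : phi x = 0) ?mulr0 ?normr0//.
apply/eqP; apply: contrapT => /negP px; move/negP: xK; apply; apply/mem_set.
exact: subset_closure.
Qed.

(** Dominated convergence along the bumps, which take values in [0, 1] and tend to the indicator of
    the open box; |w| cut off to the closed box dominates. *)
Lemma integral_obox0 Omega w a b : open Omega -> loc_integrable Omega w ->
  (forall phi, test_function Omega phi -> \int[mu]_(x in Omega) (w x * phi x) = 0) ->
  cbox a b `<=` Omega -> (\int[mu]_(x in obox a b) (w x)%:E = 0)%E.
Proof.
move=> oO wl w0 abO; have [mw wi] := wl.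
have mO := open_measurable_rV oO; have mU := measurable_obox a b.
have cK : compact (cbox a b) by exact: compact_cbox.
have mK := compact_measurable_rV cK.
have UO : obox a b `<=` Omega by apply: subset_trans abO; exact: obox_sub_cbox.
have gi : mu.-integrable Omega (abse \o ((EFin \o w) \_ (cbox a b))).
  by apply: integrable_abse; apply/integrable_restrict => //; rewrite setIidr//; exact: wi.
have [] := @dominated_convergence _ _ R mu Omega mO
  (fun k x => (w x * bump a b k x)%:E) (fun x => (w x * \1_(obox a b) x)%:E) _ _ _ _ gi.
- move=> k; apply/measurable_EFinP; apply: measurable_funM => //.
  exact/continuous_measurable_rV/flat_algebra_continuous/bump_flat_algebra.
- apply/measurable_EFinP; apply: measurable_funM => //.
- apply: aeW => x Ox; apply: cvg_EFin; first exact: nearW.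
  by apply: cvgM; [exact: cvg_cst|exact: bump_cvg].
- apply: aeW => x k Ox /=; rewrite patchE.
  have [xU|xU] := pselect (obox a b x).
    rewrite mem_set/=; last exact: obox_sub_cbox.
    rewrite lee_fin normrM ler_piMr//.
    by have /andP[b0 b1] := bump_itv a b k x; rewrite ger0_norm.
  by rewrite bump_out// mulr0 normr0 abse_ge0.
move=> _ _; rewrite (_ : (fun k => _) = cst 0%E); last first.
  apply/funext => k.
  have tb := bump_test_function k abO.
  (* The real integral is the [fine] part of the extended one and would also be 0 for an infinite
     value; integrability excludes that. *)
  have := w0 _ tb; rewrite /Rintegral => /eqP; rewrite fine_eq0; first by move/eqP.
  exact/integrable_fin_num/loc_integrable_mul_test.
move=> /cvg_lim; rewrite lim_cst// => /(_ (@ereal_hausdorff _)) h.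
rewrite [RHS]h [LHS]integral_mkcond [RHS]integral_mkcond.
apply: eq_integral => x _; rewrite !patchE indicE.
case: ifPn => [xU|xU].
  by rewrite mem_set ?mulr1//; apply/UO/set_mem.
by rewrite mulr0; case: ifP.
Qed.

(** Countably many boxes cover Omega, so one box U with closure in Omega is enough. There w is
    integrable, and its integral is shown to vanish over every measurable subset of U. *)
Lemma fundamental_lemma Omega w : open Omega -> loc_integrable Omega w ->
  (forall phi, test_function Omega phi -> \int[mu]_(x in Omega) (w x * phi x) = 0) ->
  {ae mu, forall x, Omega x -> w x = 0}.
Proof.
move=> oO wl w0; have [mw wi] := wl.
have [a [b [abO OU]]] := open_bigcup_obox oO.
suff h k : mu.-negligible [set x | ~ (obox (a k) (b k) x -> w x = 0)].
  apply: negligibleS (negligible_bigcup h) => x /= /not_implyP[].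
  by rewrite OU => -[k _ kx] wx; exists k => //= /(_ kx).
set U := obox (a k) (b k).
have mU : measurable U by exact: measurable_obox.
have cK : compact (cbox (a k) (b k)) by exact: compact_cbox.
have mK := compact_measurable_rV cK.
have UK : U `<=` cbox (a k) (b k) by exact: obox_sub_cbox.
have iU : mu.-integrable U (EFin \o w) by apply: integrableS (wi _ cK (abO k)).
have UM : bounded_set U.
  have [M [Mr h]] := compact_bounded cK; exists M; split => // r Mr' x /UK; exact: h.
have Uoo : (mu U < +oo)%E by exact: bounded_lebesgue_fin.
have iT : mu.-integrable setT ((EFin \o w) \_ U) by apply/(integrable_mkcond _ mU).
have key := integral0_measurable iT.
have : ae_eq mu U (EFin \o w) (cst 0%E).
  apply: integral_ae_eq => // A AU mA; rewrite integral0.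
  rewrite (_ : (\int[mu]_(x in A) _)%E = \int[mu]_(x in A) ((EFin \o w) \_ U) x)%E; last first.
    by apply: eq_integral => x /set_mem xA; rewrite patchE mem_set//; exact: AU.
  apply: key => //; last by rewrite (le_lt_trans _ Uoo)// le_lebesgue_outer.
  apply: integral0_sigma_algebra => //.
  - exact: oboxes_setI.
  - by move=> _ [c [d ->]]; exact: measurable_obox.
  - rewrite -integral_mkcond; exact: integral_obox0 (abO k).
  (* The intersection of U with an open box is again an open box, and its closed version stays
     inside [cbox (a k) (b k)]. *)
  - move=> _ [c [d ->]]; rewrite -integral_mkcondr obox_setI.
    apply: (integral_obox0 oO wl w0) => x h; apply: (abO k) => i.
    by have := h i; rewrite !mxE ge_max le_min => /andP[/andP[_ ->] /andP[_ ->]].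
by apply: negligibleS => x /= h1 h2; apply: h1 => Ux; have [] := h2 Ux.
Qed.

End fundamental_lemma.

(** * Weak derivatives *)

Section integral_derivative.
Context {R : realType} {n : nat}.
Local Notation mu := (@lebesgue_rV R n).
Implicit Types (x : 'rV[R]_n.+1) (f psi : 'rV[R]_n.+1 -> R).

Lemma compact_supp_integrable f K : continuous f -> compact K ->
  (forall x, ~ K x -> f x = 0) -> mu.-integrable setT (EFin \o f).
Proof.
move=> cf cK f0; have mK := compact_measurable_rV cK.
rewrite (_ : EFin \o f = (EFin \o f) \_ K).
  by apply/(integrable_mkcond _ mK); exact: continuous_compact_integrable.
apply/funext => x; rewrite patchE; case: ifPn => // /negP xK /=.
by rewrite f0// => Kx; apply: xK; exact/mem_set.
Qed.

(** A sequential form of the derivative, with increments 1/(k+1), suited to dominated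
    convergence. *)
Lemma derivable_cvg_harmonic f (v x : 'rV[R]_n.+1) : derivable f x v ->
  k.+1%:R * (f (x + k.+1%:R^-1 *: v) - f x) @[k --> \oo] --> 'D_v f x.
Proof.
move=> /cvgr_dnbhsP/(_ (fun k => k.+1%:R^-1)) df.
apply: cvg_trans (df _); last by split => //; exact: cvg_harmonic.
apply: near_eq_cvg; apply: nearW => k /=.
by rewrite invrK [x + _]addrC.
Qed.

(** By translation invariance every difference quotient of psi has integral 0. They converge to the
    derivative and are dominated by a constant on a compact box. *)
Lemma integral_derive0 psi i : continuous psi ->
  (forall x, derivable psi x (delta_mx 0 i)) ->
  continuous ('D_(delta_mx 0 i) psi) ->
  compact (closure [set x | psi x != 0]) ->
  (\int[mu]_x ('D_(delta_mx 0 i) psi x)%:E = 0)%E.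
Proof.
move=> cpsi dpsi cdpsi cK; set K := closure _ in cK; set e := delta_mx 0 i.
have [M M0 KM] := bounded_sub_obox (compact_bounded cK).
(* The margin 1 ensures that a point outside B, shifted by h e with 0 <= h <= 1, still misses the
   support of psi. *)
pose B := cbox (const_mx (- (M + 1))) (const_mx (M + 1)) : set 'rV[R]_n.+1.
have cB : compact B by exact: compact_cbox.
have mB := compact_measurable_rV cB.
have out0 (h : R) x : 0 <= h <= 1 -> ~ B x -> psi (x + h *: e) = 0.
  move=> /andP[h0 h1] Bx; apply/eqP; apply: contrapT => /negP px; apply: Bx => j.
  have Kx : K (x + h *: e) by exact: subset_closure.
  have := KM _ Kx j; rewrite !mxE eqxx/=.
  by case: (j == i); rewrite ?mulr1 ?mulr0 => /andP[? ?]; apply/andP; split; lra.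
have out x : ~ B x -> psi x = 0.
  by move=> Bx; rewrite -[x]addr0 -(scale0r e) out0// lexx ler01.
have Dout x : ~ K x -> 'D_e psi x = 0 by exact: derive_out_supp.
have [C C0 DC] : exists2 C, 0 <= C & forall x, `|'D_e psi x| <= C.
  have /compact_bounded[C [Cr fC]] := continuous_compact (continuous_subspaceT cdpsi) cK.
  exists (`|C| + 1) => [|x]; first by rewrite addr_ge0.
  have [Kx|/Dout ->] := pselect (K x); last by rewrite normr0 addr_ge0.
  apply: fC; last by exists x.
  by rewrite (le_lt_trans (ler_norm _))// ltrDl.
have k01 (k : nat) : 0 <= (k.+1%:R^-1 : R) <= 1.
  by rewrite invr_ge0 ler0n/= invf_le1// ler1n.
(* The mean value theorem on the segment from x to x + h e bounds the difference quotients by C,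
   uniformly in k. *)
have Lip (h : R) x : 0 <= h -> `|psi (x + h *: e) - psi x| <= C * h.
  move=> h0.
  have [t _] : exists2 t : R, t \in `[0, h] & psi (h *: e + x) - psi (0 *: e + x) =
      'D_e psi (t *: e + x) * (h - 0).
    apply: (@MVT_segment R (fun t : R => psi (t *: e + x))
      (fun t : R => 'D_e psi (t *: e + x))) => // [t _|].
      by apply/is_derive_line; apply: DeriveDef.
    apply: continuous_subspaceT => t.
    apply: (@continuous_comp _ _ _ (fun t : R => t *: e + x) psi); last exact: cpsi.
    by apply: continuousD; [exact: scalel_continuous|exact: cst_continuous].
  rewrite scale0r add0r subr0 [x + _]addrC => ->.
  by rewrite normrM ler_pM// ger0_norm.
pose q (k : nat) x := k.+1%:R * (psi (x + k.+1%:R^-1 *: e) - psi x).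
have cs (k : nat) : continuous (fun x => psi (x + k.+1%:R^-1 *: e)).
  move=> x; apply: (@continuous_comp _ _ _ (fun x => x + k.+1%:R^-1 *: e) psi);
    last exact: cpsi.
  by apply: continuousD; [exact: cvg_id|exact: cst_continuous].
have ipsi := compact_supp_integrable cpsi cB out.
have ips (k : nat) := compact_supp_integrable (cs k) cB (fun x => @out0 _ x (k01 k)).
have gi : mu.-integrable setT ((cst C%:E) \_ B).
  apply/(integrable_mkcond _ mB).
  exact: (continuous_compact_integrable (@cst_continuous _ _ C)).
have [] := @dominated_convergence _ _ R mu setT measurableT
  (fun k x => (q k x)%:E) (fun x => ('D_e psi x)%:E) _ _ _ _ gi _.
- move=> k; apply/measurable_EFinP; apply: measurable_funM; first exact: measurable_cst.
  by apply: measurable_funB; exact: continuous_measurable_rV.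
- by apply/measurable_EFinP; exact: continuous_measurable_rV.
- apply: aeW => x _; apply: cvg_EFin; first exact: nearW.
  exact: derivable_cvg_harmonic.
- apply: aeW => x k _; rewrite patchE /q; case: ifPn => [_|/negP xB].
    rewrite lee_fin normrM ger0_norm// -ler_pdivlMl// mulrC.
    by apply: Lip; have /andP[] := k01 k.
  have Bx : ~ B x by move=> ?; apply: xB; exact/mem_set.
  by rewrite out0// out// subr0 mulr0 abse0.
move=> _ _; rewrite (_ : (fun k => _) = cst 0%E); last first.
  apply/funext => k; rewrite /q.
  under eq_integral do rewrite EFinM.
  rewrite integralZl//; last first.
    have := integrableB measurableT (ips k) ipsi; apply: eq_integrable => //.
  under eq_integral do rewrite EFinB.
  have mpsi : measurable_fun setT psi by exact: continuous_measurable_rV.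
  rewrite integralB_EFin//.
  rewrite (integral_shift mpsi ipsi (ips k)).
  rewrite subee ?mule0//; exact: integrable_fin_num.
by move=> /cvg_lim; rewrite lim_cst// => /(_ (@ereal_hausdorff _)).
Qed.

End integral_derivative.

Section weak_derivatives.
Context {R : realType} {n : nat}.
Local Notation mu := (@lebesgue_rV R n).
Implicit Types (Omega : set 'rV[R]_n.+1) (s : seq 'I_n.+1).
Implicit Types (u v w phi : 'rV[R]_n.+1 -> R).

Lemma loc_integrableB Omega u v : loc_integrable Omega u ->
  loc_integrable Omega v -> loc_integrable Omega (fun x => u x - v x).
Proof.
move=> [mu_ iu] [mv iv]; split; first exact: measurable_funB.
move=> K cK KO; have mK := compact_measurable_rV cK.
by have := integrableB mK (iu _ cK KO) (iv _ cK KO); apply: eq_integrable.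
Qed.

Lemma Rintegral_test_B Omega u v phi : open Omega -> loc_integrable Omega u ->
  loc_integrable Omega v -> test_function Omega phi ->
  \int[mu]_(x in Omega) ((u x - v x) * phi x) =
  \int[mu]_(x in Omega) (u x * phi x) - \int[mu]_(x in Omega) (v x * phi x).
Proof.
move=> oO lu lv tp; have mO := open_measurable_rV oO.
rewrite -RintegralB//; [|exact: loc_integrable_mul_test..].
by apply: eq_Rintegral => x _; rewrite mulrBl.
Qed.

(** The difference v - v' is orthogonal to all test functions. *)
Lemma is_weak_partials_unique Omega s u v v' : open Omega ->
  is_weak_partials Omega s u v -> is_weak_partials Omega s u v' ->
  {ae mu, forall x, Omega x -> v x = v' x}.
Proof.
move=> oO [lu lv uv] [_ lv' uv'].
have : {ae mu, forall x, Omega x -> v x - v' x = 0}.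
  apply: (fundamental_lemma oO); first exact: loc_integrableB.
  move=> phi tp; rewrite Rintegral_test_B//; apply/eqP; rewrite subr_eq0.
  apply/eqP/(@mulfI _ ((-1) ^+ size s)); first by rewrite signr_eq0.
  by rewrite -uv// uv'.
by apply: filterS => x h Ox; apply/eqP; rewrite -subr_eq0 h.
Qed.

Lemma weak_partialsP Omega s u v : is_weak_partials Omega s u v ->
  is_weak_partials Omega s u (weak_partials Omega s u).
Proof. by move=> uv; apply: (@xgetPex _ (cst 0) [set v | is_weak_partials Omega s u v]); exists v. Qed.

Lemma weak_partials_ae Omega s u v : open Omega -> is_weak_partials Omega s u v ->
  {ae mu, forall x, Omega x -> weak_partials Omega s u x = v x}.
Proof. by move=> oO uv; apply: is_weak_partials_unique (weak_partialsP uv) uv. Qed.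

Lemma is_weak_partialsB Omega s u u' v v' : open Omega ->
  is_weak_partials Omega s u v -> is_weak_partials Omega s u' v' ->
  is_weak_partials Omega s (fun x => u x - u' x) (fun x => v x - v' x).
Proof.
move=> oO [lu lv uv] [lu' lv' uv']; split; [exact: loc_integrableB..|].
move=> phi tp; rewrite !Rintegral_test_B//; last exact: test_function_partials.
by rewrite uv// uv'// mulrBr.
Qed.

Lemma is_weak_partials_nil Omega u : loc_integrable Omega u ->
  is_weak_partials Omega [::] u u.
Proof. by move=> lu; split => // phi _; rewrite expr0 mul1r. Qed.

(** Using d_j phi as test function for v produces d_i (d_j phi), the order in which [partials
    [:: i; j]] differentiates. This lets the Poincare inequality be applied to the partial
    derivatives of u. *)
Lemma is_weak_partials_cons Omega i j u v w :
  is_weak_partials Omega [:: i] u v -> is_weak_partials Omega [:: i; j] u w ->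
  is_weak_partials Omega [:: j] v w.
Proof.
move=> [lu lv uv] [_ lw uw]; split => // phi tp.
have := uv _ (test_function_D j tp); rewrite /= (uw _ tp)/=.
by rewrite expr1 sqrrN expr1n mul1r !mulN1r => ->; rewrite opprK.
Qed.

Definition affine (c : R) (p : 'rV[R]_n.+1) (x : 'rV[R]_n.+1) : R := c + dot p x.

Lemma continuousD_rV u v : continuous u -> continuous v ->
  continuous (fun x => u x + v x).
Proof. by move=> cu cv x; apply: continuousD; [exact: cu|exact: cv]. Qed.

Lemma continuousM_rV u v : continuous u -> continuous v ->
  continuous (fun x => u x * v x).
Proof. by move=> cu cv x; apply: continuousM; [exact: cu|exact: cv]. Qed.

Lemma continuous_sum (I : Type) (r : seq I) (F : I -> 'rV[R]_n.+1 -> R) :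
  (forall i, continuous (F i)) -> continuous (fun x => \sum_(i <- r) F i x).
Proof.
move=> cF; elim: r => [|i r ih].
  rewrite (_ : (fun x => _) = cst 0); first by move=> x; exact: cst_continuous.
  by apply/funext => x; rewrite big_nil.
rewrite (_ : (fun x => _) = fun x => F i x + \sum_(j <- r) F j x).
  by move=> x; apply: continuousD; [exact: cF|exact: ih].
by apply/funext => x; rewrite big_cons.
Qed.

Lemma affine_continuous c p : continuous (affine c p).
Proof.
move=> x; apply: continuousD; first exact: cst_continuous.
apply: continuous_sum => i {}x.
by apply: continuousM; [exact: cst_continuous|exact: coord_continuous].
Qed.

Lemma is_derive_affine c p (x : 'rV[R]_n.+1) i :
  is_derive x (delta_mx 0 i) (affine c p) (p 0 i).
Proof.
have {1}-> : x = 0 *: delta_mx 0 i + x by rewrite scale0r add0r.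
apply/is_derive_line.
have -> : (fun h : R => affine c p (h *: delta_mx 0 i + x)) =
    (fun h : R => p 0 i * h + affine c p x).
  apply/funext => h; rewrite /affine /dot addrCA; congr (_ + _).
  rewrite (_ : p 0 i * h = \sum_j p 0 j * (h * (j == i)%:R)).
    by rewrite -big_split/=; apply: eq_bigr => j _; rewrite !mxE eqxx/= mulrDr.
  rewrite (bigD1 i)//= eqxx mulr1 big1 ?addr0// => j /negbTE ->.
  by rewrite !mulr0.
have h1 : is_derive (0 : R) 1 (fun h : R => p 0 i * h) (p 0 i *: 1).
  exact: (@is_deriveZ _ _ _ (@id R) (p 0 i) 0 1 1).
rewrite [X in is_derive _ _ _ X](_ : _ = p 0 i *: 1 + 0); last first.
  by rewrite addr0 /GRing.scale/= mulr1.
exact: is_deriveD.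
Qed.

Lemma continuous_loc_integrable Omega u : continuous u -> loc_integrable Omega u.
Proof.
move=> cu; split; first exact: continuous_measurable_rV.
by move=> K cK _; exact: continuous_compact_integrable.
Qed.

(** Integration by parts: the product psi of the affine function and phi has compact support in
    Omega, so its derivative vanishes off Omega and integrates to 0 by [integral_derive0]. *)
Lemma affine_weak_partial Omega c p i : open Omega ->
  is_weak_partials Omega [:: i] (affine c p) (cst (p 0 i)).
Proof.
move=> oO; have mO := open_measurable_rV oO.
have la : loc_integrable Omega (affine c p).
  by apply: continuous_loc_integrable; exact: affine_continuous.
have lc : loc_integrable Omega (cst (p 0 i)).
  by apply: continuous_loc_integrable; exact: cst_continuous.
split => // phi tp.
have tDp := test_function_D i tp; have [sp cK KO] := tp.
have cp := test_function_continuous tp.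
have cDp := test_function_continuous tDp.
pose psi x := affine c p x * phi x.
have dpsi x : is_derive x (delta_mx 0 i) psi
    (affine c p x * 'D_(delta_mx 0 i) phi x + phi x * p 0 i).
  apply: is_deriveM; first exact: is_derive_affine.
  by apply: DeriveDef => //; have [_] := sp [::]; exact.
have Dpsi : 'D_(delta_mx 0 i) psi =
    fun x => affine c p x * 'D_(delta_mx 0 i) phi x + phi x * p 0 i.
  by apply/funext => x; have [] := dpsi x.
have sub : closure [set x | psi x != 0] `<=` closure [set x | phi x != 0].
  by apply: closure_subset => x /=; rewrite mulf_eq0 negb_or => /andP[].
have := @integral_derive0 R n psi i.
rewrite Dpsi => h.
rewrite /= expr1 mulN1r; apply/eqP; rewrite -addr_eq0 -RintegralD//;
  [|exact: loc_integrable_mul_test..].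
rewrite /Rintegral; apply/eqP; rewrite (_ : (\int[mu]_(x in Omega) _)%E = 0%E)//.
rewrite -[RHS]h.
- rewrite [LHS]integral_mkcond; apply: eq_integral => x _; rewrite patchE.
  transitivity (affine c p x * 'D_(delta_mx 0 i) phi x + phi x * p 0 i)%:E; last first.
    by apply: congr1; apply: esym; have [_] := dpsi x.
  case: ifPn => [_|/negP xO]; first by rewrite /cst [phi x * _]mulrC.
  have nK : ~ closure [set x | phi x != 0] x.
    by move=> /KO Ox; apply: xO; exact/mem_set.
  rewrite derive_out_supp// mulr0 add0r (_ : phi x = 0) ?mul0r//.
  by apply/eqP; apply: contrapT => /negP ?; apply: nK; exact: subset_closure.
- by move=> x; apply: continuousM; [exact: affine_continuous|exact: cp].
- by move=> x; have [] := dpsi x.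
- pose dphi : 'rV[R]_n.+1 -> R := 'D_(delta_mx 0 i) phi.
  have cF : continuous (fun x => affine c p x * dphi x + phi x * p 0 i).
    apply: continuousD_rV; apply: continuousM_rV => //.
    + exact: affine_continuous.
    + by move=> x; exact: cst_continuous.
  exact: cF.
- by apply: subclosed_compact sub => //; exact: closed_closure.
Qed.

(** The first-order result is used twice: with test function d_j phi, and then for the constant p_i,
    seen as an affine function with zero gradient. *)
Lemma affine_weak_partial2 Omega c p i j : open Omega ->
  is_weak_partials Omega [:: i; j] (affine c p) (cst 0).
Proof.
move=> oO; have [la _ h1] := affine_weak_partial c p i oO.
have [_ l0 h2] := affine_weak_partial (p 0 i) 0 j oO.
split => // [|phi tp].
  by apply: continuous_loc_integrable; exact: cst_continuous.
rewrite /= (h1 _ (test_function_D j tp)) sqrrN expr1n mul1r expr1 mulN1r.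
have := h2 _ tp; rewrite /= !mxE expr1 mulN1r => h3.
rewrite -[RHS]opprK -h3; congr (- _); apply: eq_Rintegral => x _.
congr (_ * _); rewrite /affine /dot big1 ?addr0// => k _.
by rewrite mxE mul0r.
Qed.

End weak_derivatives.

(** * Square integrable functions and Sobolev derivatives *)

Section square_integrable.
Context {R : realType} {n : nat}.
Local Notation mu := (@lebesgue_rV R n).
Implicit Types (Omega F : set 'rV[R]_n.+1) (s : seq 'I_n.+1).
Implicit Types (u v w : 'rV[R]_n.+1 -> R).

Lemma L2_S Omega F u : measurable Omega -> measurable F -> F `<=` Omega ->
  L2 Omega u -> L2 F u.
Proof.
move=> mO mF FO [mu_ iu]; split; first exact: measurable_funS mu_.
exact: integrableS iu.
Qed.

(** On a set of finite measure the integrable function 1 + u^2 dominates |u|. *)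
Lemma L2_integrable Omega u : measurable Omega -> (mu Omega < +oo)%E ->
  L2 Omega u -> mu.-integrable Omega (EFin \o u).
Proof.
move=> mO Ooo [mu_ iu].
have i1 : mu.-integrable Omega (EFin \o cst 1).
  apply: measurable_bounded_integrable => //.
  by exists 1; split => // y y1 x _; rewrite /= normr1 ltW.
apply: le_integrable (integrableD mO i1 iu) => //; first exact/measurable_EFinP.
move=> x _ /=; rewrite lee_fin [leRHS]ger0_norm ?addr_ge0 ?sqr_ge0//.
have := sqr_ge0 (`|u x| - 1); rewrite -[u x ^+ 2]real_normK ?num_real//.
by have := normr_ge0 (u x); nra.
Qed.

Lemma L2_loc_integrable Omega u : open Omega -> L2 Omega u -> loc_integrable Omega u.
Proof.
move=> oO Lu; have mO := open_measurable_rV oO.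
split; first by case: Lu.
move=> K cK KO; have mK := compact_measurable_rV cK.
apply: L2_integrable => //; last exact: L2_S Lu.
exact/bounded_lebesgue_fin/compact_bounded.
Qed.

Lemma L2B Omega u v : measurable Omega -> L2 Omega u -> L2 Omega v ->
  L2 Omega (fun x => u x - v x).
Proof.
move=> mO [mu_ iu] [mv iv]; have muv := measurable_funB mu_ mv; split => //.
have h := integrableZl mO 2 (integrableD mO iu iv).
apply: le_integrable h => //.
  by apply/measurable_EFinP; exact: measurable_funX.
move=> x _ /=; rewrite lee_fin !ger0_norm ?sqr_ge0//; last first.
  by rewrite mulr_ge0// addr_ge0 ?sqr_ge0.
have := sqr_ge0 (u x + v x); nra.
Qed.

Lemma L2_continuous Omega u : open Omega -> bounded_set Omega -> continuous u ->
  L2 Omega u.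
Proof.
move=> oO bO cu; have mO := open_measurable_rV oO.
split; first exact: continuous_measurable_rV.
have [M _ OM] := bounded_sub_obox bO.
have cK : compact (cbox (const_mx (- M)) (const_mx M) : set 'rV[R]_n.+1).
  exact: compact_cbox.
apply: (@integrableS _ _ _ _ (cbox (const_mx (- M)) (const_mx M))) => //.
- exact: compact_measurable_rV.
- exact: subset_trans OM (@obox_sub_cbox _ _ _ _).
- apply: (@continuous_compact_integrable _ _ (fun x => u x ^+ 2)) => // x.
  by apply: continuousM; exact: cu.
Qed.

Lemma L2_ae Omega u v : measurable Omega -> L2 Omega u -> measurable_fun Omega v ->
  {ae mu, forall x, Omega x -> v x = u x} -> L2 Omega v.
Proof.
move=> mO [mu_ iu] mv vu; split => //.
have [m2 i2] := integrableP _ _ _ iu.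
apply/integrableP; split.
  by apply/measurable_EFinP; exact: measurable_funX.
rewrite (ae_eq_integral (abse \o (EFin \o (fun x => u x ^+ 2))))//.
- apply: measurableT_comp => //.
  by apply/measurable_EFinP; exact: measurable_funX.
- exact: measurableT_comp.
- by apply: filterS vu => x h Ox /=; rewrite h.
Qed.

(** The definition of [sobolev] provides some square integrable weak derivative; the chosen
    representative agrees with it almost everywhere and inherits square integrability. *)
Lemma sobolev_weak_partials k Omega s u : open Omega -> sobolev k Omega u ->
  (size s <= k)%N ->
  L2 Omega (weak_partials Omega s u) /\
  is_weak_partials Omega s u (weak_partials Omega s u).
Proof.
move=> oO [_ su] sk; have [v Lv uv] := su s sk.
have uw := weak_partialsP uv; split => //.
have mO := open_measurable_rV oO.
apply: L2_ae Lv _ _ => //; first by case: uw => _ [].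
exact: weak_partials_ae.
Qed.

End square_integrable.

(** * Averages and the Poincare inequality *)

Section real_integrals.
Context {d : measure_display} {T : measurableType d} {R : realType}.
Variables (mu : {measure set T -> \bar R}) (D : set T).
Hypothesis mD : measurable D.
Implicit Types f g : T -> R.

Lemma integrable_EFinD f g : mu.-integrable D (EFin \o f) ->
  mu.-integrable D (EFin \o g) -> mu.-integrable D (EFin \o (fun x => f x + g x)).
Proof. by move=> fi gi; have := integrableD mD fi gi; apply: eq_integrable. Qed.

Lemma integrable_EFinZl (k : R) f : mu.-integrable D (EFin \o f) ->
  mu.-integrable D (EFin \o (fun x => k * f x)).
Proof. by move=> fi; have := integrableZl mD k fi; apply: eq_integrable. Qed.

Lemma integrable_EFin_sum (I : Type) (r : seq I) (F : I -> T -> R) :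
  (forall i, mu.-integrable D (EFin \o F i)) ->
  mu.-integrable D (EFin \o (fun x => \sum_(i <- r) F i x)).
Proof.
move=> Fi; have := integrable_sum mD r (P := xpredT) (fun i _ => Fi i).
by apply: eq_integrable => // x _ /=; rewrite sumEFin.
Qed.

Lemma Rintegral_sum (I : Type) (r : seq I) (F : I -> T -> R) :
  (forall i, mu.-integrable D (EFin \o F i)) ->
  \int[mu]_(x in D) (\sum_(i <- r) F i x) = \sum_(i <- r) \int[mu]_(x in D) F i x.
Proof.
move=> Fi; elim: r => [|i r ih].
  rewrite big_nil (eq_Rintegral _ (g := cst 0)) ?Rintegral_cst ?mul0r// => x _.
  by rewrite big_nil.
rewrite big_cons -ih -RintegralD//; last exact: integrable_EFin_sum.
by apply: eq_Rintegral => x _; rewrite big_cons.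
Qed.

Lemma ae_forall_fin (I : finType) (P : I -> T -> Prop) :
  (forall i, {ae mu, forall x, P i x}) -> {ae mu, forall x i, P i x}.
Proof. exact: filter_forall. Qed.

Lemma Rintegral_ae_eq f g : measurable_fun D f -> measurable_fun D g ->
  {ae mu, forall x, D x -> f x = g x} ->
  \int[mu]_(x in D) f x = \int[mu]_(x in D) g x.
Proof.
move=> mf mg fg; rewrite /Rintegral; congr fine; apply: ae_eq_integral => //.
- exact/measurable_EFinP.
- exact/measurable_EFinP.
- by apply: filterS fg => x h Dx; rewrite h.
Qed.

Lemma integrable_EFin_cst (c : R) : (mu D < +oo)%E -> mu.-integrable D (EFin \o cst c).
Proof.
move=> Doo; apply: measurable_bounded_integrable => //.
by exists `|c|; split => // y y1 x _; rewrite /= ltW.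
Qed.

Lemma Rintegral_subset A f : measurable A -> A `<=` D ->
  mu.-integrable D (EFin \o f) -> (forall x, D x -> 0 <= f x) ->
  \int[mu]_(x in A) f x <= \int[mu]_(x in D) f x.
Proof.
move=> mA AD fi f0; have fiA := integrableS mD mA AD fi.
apply: fine_le; [exact: integrable_fin_num|exact: integrable_fin_num|].
by apply: ge0_subset_integral => //; exact: measurable_int fi.
Qed.

End real_integrals.

Section finite_sums.
Context {R : realType}.

(** Cauchy-Schwarz: the sum of the squares (B a_i - S b_i)^2 equals B (A B - S^2), and B > 0 unless
    b = 0. *)
Lemma dot_sqr_le n (a b : 'rV[R]_n) :
  dot a b ^+ 2 <= (\sum_i a 0 i ^+ 2) * (\sum_i b 0 i ^+ 2).
Proof.
set A := \sum_i a 0 i ^+ 2; set B := \sum_i b 0 i ^+ 2; set S := dot a b.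
have [B0|B0] := eqVneq B 0.
  have b0 i : b 0 i = 0.
    apply/eqP; rewrite -sqrf_eq0; apply/eqP.
    by move: B0 => /psumr_eq0P; apply => // j _; rewrite sqr_ge0.
  by rewrite /S /dot big1 ?expr0n ?B0 ?mulr0// => i _; rewrite b0 mulr0.
have Bp : 0 < B by rewrite lt_neqAle eq_sym B0 sumr_ge0// => i _; rewrite sqr_ge0.
have : 0 <= \sum_i (B * a 0 i - S * b 0 i) ^+ 2.
  by apply: sumr_ge0 => i _; rewrite sqr_ge0.
rewrite (_ : \sum_i _ = B * (A * B - S ^+ 2)).
  by rewrite pmulr_rge0// subr_ge0.
transitivity (B ^+ 2 * A - 2 * B * S * S + S ^+ 2 * B); last by ring.
have -> : B ^+ 2 * A = \sum_i B ^+ 2 * a 0 i ^+ 2 by rewrite mulr_sumr.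
have -> : 2 * B * S * S = \sum_i 2 * B * S * (a 0 i * b 0 i) by rewrite -mulr_sumr.
have -> : S ^+ 2 * B = \sum_i S ^+ 2 * b 0 i ^+ 2 by rewrite -mulr_sumr.
rewrite -sumrN -!big_split/=.
by apply: eq_bigr => i _; ring.
Qed.

Lemma enorm_sqr p q (A : 'M[R]_(p, q)) :
  enorm A ^+ 2 = \sum_i \sum_j A i j ^+ 2.
Proof.
by rewrite sqr_sqrtr// sumr_ge0// => i _; rewrite sumr_ge0// => j _; rewrite sqr_ge0.
Qed.

Lemma enorm_row_sqr n (a : 'rV[R]_n) : enorm a ^+ 2 = \sum_j a 0 j ^+ 2.
Proof. by rewrite enorm_sqr big_ord1. Qed.

(** Weighted Young inequality; the difference of the two sides is (K a + b)^2 / K. *)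
Lemma sqrB_le (K a b : R) : 0 < K ->
  (a - b) ^+ 2 <= (1 + K) * a ^+ 2 + (1 + K^-1) * b ^+ 2.
Proof.
move=> K0; rewrite -subr_ge0.
rewrite (_ : _ - _ = (K * a + b) ^+ 2 / K); last by field; rewrite gt_eqF.
by rewrite divr_ge0 ?sqr_ge0 ?ltW.
Qed.

End finite_sums.

Section averages.
Context {R : realType} {n : nat}.
Local Notation mu := (@lebesgue_rV R n).
Implicit Types (F Omega : set 'rV[R]_n.+1) (f g : 'rV[R]_n.+1 -> R).

Lemma vol_gt0 F : (0 < mu F)%E -> (mu F < +oo)%E -> 0 < vol F.
Proof. by move=> F0 Foo; rewrite fine_gt0// F0 Foo. Qed.

Variable F : set 'rV[R]_n.+1.
Hypotheses (mF : measurable F) (F0 : (0 < mu F)%E) (Foo : (mu F < +oo)%E).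

Lemma averageB f g : mu.-integrable F (EFin \o f) -> mu.-integrable F (EFin \o g) ->
  average F (fun x => f x - g x) = average F f - average F g.
Proof. by move=> fi gi; rewrite /average RintegralB// mulrBr. Qed.

Lemma average_cst (c : R) : average F (fun=> c) = c.
Proof.
by rewrite /average Rintegral_cst// mulrCA mulVf ?mulr1// gt_eqF// vol_gt0.
Qed.

(** Jensen's inequality for the square, read off from the nonnegative integral of (f - m)^2 with m
    the average of f. *)
Lemma average_sqr_le f : L2 F f ->
  average F f ^+ 2 <= (vol F)^-1 * \int[mu]_(x in F) f x ^+ 2.
Proof.
move=> Lf; have fi := L2_integrable mF Foo Lf; have [mf f2i] := Lf.
have F1 := vol_gt0 F0 Foo; set m := average F f.
have : 0 <= \int[mu]_(x in F) (f x - m) ^+ 2.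
  by apply: Rintegral_ge0 => x _; rewrite sqr_ge0.
rewrite (eq_Rintegral _ (g := fun x => f x ^+ 2 + (- 2 * m * f x + m ^+ 2))); last first.
  by move=> x _; ring.
have cstF := integrable_EFin_cst mF (m ^+ 2) Foo.
have fZ := integrable_EFinZl mF (- 2 * m) fi.
rewrite RintegralD//; last exact: integrable_EFinD.
rewrite RintegralD// RintegralZl// Rintegral_cst//.
have If : \int[mu]_(x in F) f x = vol F * m by rewrite /m /average mulVKf ?gt_eqF.
rewrite If -/(vol F) ler_pdivlMl// => h; rewrite -subr_ge0.
by apply: le_trans h _; rewrite le_eqVlt; apply/orP; left; apply/eqP; ring.
Qed.

Lemma average_affine c p :
  (forall i, mu.-integrable F (EFin \o (fun x : 'rV[R]_n.+1 => x 0 i))) ->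
  average F (affine c p) = affine c p (center_of_mass F).
Proof.
move=> ci; rewrite /average /affine.
have pi i := integrable_EFinZl mF (p 0 i) (ci i).
rewrite RintegralD//; first last.
- exact: (integrable_EFin_sum mF (index_enum _) pi).
- exact: (integrable_EFin_cst mF c Foo).
rewrite Rintegral_cst// mulrDr; congr (_ + _).
  by rewrite mulrCA mulVf ?mulr1// gt_eqF// vol_gt0.
rewrite /dot Rintegral_sum// mulr_sumr; apply: eq_bigr => i _.
by rewrite RintegralZl// /center_of_mass /vaverage mxE /average; ring.
Qed.

End averages.

Section poincare.
Context {R : realType} {n : nat}.
Local Notation mu := (@lebesgue_rV R n).
Variable Omega : set 'rV[R]_n.+1.
Hypotheses (oO : open Omega) (bO : bounded_set Omega).

(** [sup] is an upper bound only for a set that has one; the diagonal of a cube of side 2 M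
    containing Omega serves here. *)
Lemma enorm_sub_le_diam x y : Omega x -> Omega y -> enorm (x - y) <= diam Omega.
Proof.
move=> Ox Oy; apply: sup_upper_bound; last by exists x => //; exists y.
split; first by exists (enorm (x - y)); exists x => //; exists y.
have [M M0 OM] := bounded_sub_obox bO.
exists (Num.sqrt (\sum_(i < n.+1) (2 * M) ^+ 2)) => _ [z Oz [t Ot <-]].
rewrite /enorm big_ord1 ler_sqrt; last by rewrite sumr_ge0// => i _; rewrite sqr_ge0.
apply: ler_sum => i _; rewrite -[leLHS]real_normK ?num_real//.
rewrite ler_sqr ?nnegrE ?mulr_ge0 ?(ltW M0)// !mxE.
have := OM _ Oz i; have := OM _ Ot i; rewrite !mxE => /andP[? ?] /andP[? ?].
by rewrite ler_norml; apply/andP; split; lra.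
Qed.

Lemma sum_sqr_sub_le_diam x y : Omega x -> Omega y ->
  \sum_i (x 0 i - y 0 i) ^+ 2 <= diam Omega ^+ 2.
Proof.
move=> Ox Oy; have h := enorm_sub_le_diam Ox Oy.
have : enorm (x - y) ^+ 2 <= diam Omega ^+ 2.
  by rewrite ler_sqr ?nnegrE ?(le_trans _ h) ?sqrtr_ge0.
rewrite enorm_row_sqr; apply: le_trans; apply: ler_sum => i _; by rewrite !mxE.
Qed.

Lemma measurable_Omega : measurable Omega.
Proof. exact: open_measurable_rV. Qed.

Lemma Omega_lty : (mu Omega < +oo)%E.
Proof. exact: bounded_lebesgue_fin. Qed.

Lemma L2_coord i : L2 Omega (fun x => x 0 i).
Proof. by apply: L2_continuous => // x; exact: coord_continuous. Qed.

Lemma L2_affine c p : L2 Omega (affine c p).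
Proof. by apply: L2_continuous => //; exact: affine_continuous. Qed.

Lemma L2_cst (c : R) : L2 Omega (fun=> c).
Proof. by apply: L2_continuous => // x; exact: cst_continuous. Qed.

(* Jensen's inequality for the average over E of y |-> x - y. *)
Lemma center_of_mass_dist E x : measurable E -> E `<=` Omega -> (0 < mu E)%E ->
  Omega x -> \sum_i (x 0 i - center_of_mass E 0 i) ^+ 2 <= diam Omega ^+ 2.
Proof.
move=> mE EO E0 Ox; have mO := measurable_Omega.
have Eoo : (mu E < +oo)%E by rewrite (le_lt_trans _ Omega_lty)// le_lebesgue_outer.
have LE i : L2 E (fun y => x 0 i - y 0 i).
  exact: (L2_S mO mE EO (L2B mO (L2_cst (x 0 i)) (L2_coord i))).
have iE i : mu.-integrable E (EFin \o (fun y : 'rV[R]_n.+1 => (x 0 i - y 0 i) ^+ 2)).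
  by have [] := LE i.
apply: (@le_trans _ _ (\sum_i (vol E)^-1 * \int[mu]_(y in E) (x 0 i - y 0 i) ^+ 2)).
  apply: ler_sum => i _; apply: le_trans (average_sqr_le mE E0 Eoo (LE i)).
  rewrite averageB//; last 2 first.
  - exact: (integrable_EFin_cst mE (x 0 i) Eoo).
  - exact: (L2_integrable mE Eoo (L2_S mO mE EO (L2_coord i))).
  by rewrite average_cst// /center_of_mass /vaverage mxE.
rewrite -mulr_sumr -Rintegral_sum// ler_pdivrMl ?vol_gt0//.
rewrite mulrC -/(vol E) -Rintegral_cst//; apply: le_Rintegral => //.
- exact: (integrable_EFin_sum mE).
- exact: integrable_EFin_cst.
- by move=> y Ey; apply: sum_sqr_sub_le_diam => //; exact: EO.
Qed.

(** The Poincare inequality is squared, and the representatives inside [grad] are exchanged for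
    given weak derivatives [dv], equal to them almost everywhere. *)
Lemma poincare_sqr (Q : R) (v : 'rV[R]_n.+1 -> R) (dv : 'I_n.+1 -> 'rV[R]_n.+1 -> R) :
  0 < Q ->
  (forall u : 'rV[R]_n.+1 -> R, sobolev 1 Omega u ->
     L2norm Omega (fun x => u x - average Omega u) <=
     Q * L2norm Omega (fun x => enorm (grad Omega u x))) ->
  L2 Omega v -> (forall j, L2 Omega (dv j)) ->
  (forall j, is_weak_partials Omega [:: j] v (dv j)) ->
  \int[mu]_(x in Omega) (v x - average Omega v) ^+ 2 <=
  Q ^+ 2 * \int[mu]_(x in Omega) (\sum_j dv j x ^+ 2).
Proof.
move=> Q0 PQ Lv Ldv wdv; have mO := measurable_Omega.
have sv : sobolev 1 Omega v.
  split => // -[|j [|]]//= _.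
    by exists v => //; apply: is_weak_partials_nil; exact: L2_loc_integrable.
  by exists (dv j).
have Ige0 : 0 <= \int[mu]_(x in Omega) (\sum_j dv j x ^+ 2).
  by apply: Rintegral_ge0 => x _; rewrite sumr_ge0// => j _; rewrite sqr_ge0.
have := PQ _ sv; rewrite /L2norm.
rewrite (_ : \int[mu]_(x in Omega) enorm (grad Omega v x) ^+ 2 =
   \int[mu]_(x in Omega) (\sum_j dv j x ^+ 2)).
  move=> h.
  rewrite -[leLHS]sqr_sqrtr; last by apply: Rintegral_ge0 => x _; rewrite sqr_ge0.
  rewrite -[X in _ <= _ * X]sqr_sqrtr// -exprMn.
  by rewrite ler_sqr ?nnegrE ?sqrtr_ge0// mulr_ge0 ?sqrtr_ge0// ltW.
apply: (Rintegral_ae_eq mO).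
- rewrite (_ : (fun x => _) = fun x => \sum_j weak_partials Omega [:: j] v x ^+ 2); last first.
    by apply/funext => x; rewrite enorm_row_sqr; apply: eq_bigr => j _; rewrite mxE.
  apply: measurable_sum => j; apply: measurable_funX.
  by have [_ []] := weak_partialsP (wdv j).
- by apply: measurable_sum => j; apply: measurable_funX; have [] := Ldv j.
- have h j := weak_partials_ae oO (wdv j).
  apply: filterS (ae_forall_fin h) => x hx Ox.
  by rewrite enorm_row_sqr; apply: eq_bigr => j _; rewrite mxE hx.
Qed.

(** The representatives chosen for a difference need not be the pointwise differences of those
    chosen for its terms. Almost everywhere uniqueness lets the norm be computed from any
    representatives. *)
Lemma W22norm_sqr (U : 'rV[R]_n.+1 -> R) (dU : 'I_n.+1 -> 'rV[R]_n.+1 -> R)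
    (ddU : 'I_n.+1 -> 'I_n.+1 -> 'rV[R]_n.+1 -> R) :
  measurable_fun Omega U ->
  (forall i, is_weak_partials Omega [:: i] U (dU i)) ->
  (forall i j, is_weak_partials Omega [:: i; j] U (ddU i j)) ->
  W22norm Omega U = Num.sqrt (\int[mu]_(x in Omega)
    (U x ^+ 2 + \sum_i dU i x ^+ 2 + \sum_i \sum_j ddU i j x ^+ 2)).
Proof.
move=> mU w1 w2; rewrite /W22norm; congr Num.sqrt.
have mO := measurable_Omega.
apply: (Rintegral_ae_eq mO).
- rewrite (_ : (fun x => _) = fun x => U x ^+ 2 +
      \sum_j weak_partials Omega [:: j] U x ^+ 2 +
      \sum_i \sum_j weak_partials Omega [:: i; j] U x ^+ 2); last first.
    apply/funext => x; rewrite enorm_row_sqr enorm_sqr; congr (_ + _ + _).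
      by apply: eq_bigr => j _; rewrite mxE.
    by apply: eq_bigr => i _; apply: eq_bigr => j _; rewrite mxE.
  apply: measurable_funD; first apply: measurable_funD.
  + exact: measurable_funX.
  + apply: measurable_sum => j; apply: measurable_funX.
    by have [_ []] := weak_partialsP (w1 j).
  + apply: measurable_sum => i; apply: measurable_sum => j; apply: measurable_funX.
    by have [_ []] := weak_partialsP (w2 i j).
- apply: measurable_funD; first apply: measurable_funD.
  + exact: measurable_funX.
  + by apply: measurable_sum => j; apply: measurable_funX; have [_ []] := w1 j.
  + apply: measurable_sum => i; apply: measurable_sum => j; apply: measurable_funX.
    by have [_ []] := w2 i j.
- have h1 := ae_forall_fin (fun j => weak_partials_ae oO (w1 j)).
  have h2 := ae_forall_fin (fun i => ae_forall_fin (fun j => weak_partials_ae oO (w2 i j))).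
  apply: filterS2 h1 h2 => x h1 h2 Ox; rewrite enorm_row_sqr enorm_sqr.
  congr (_ + _ + _).
    by apply: eq_bigr => j _; rewrite mxE h1.
  by apply: eq_bigr => i _; apply: eq_bigr => j _; rewrite mxE h2.
Qed.

End poincare.

(** * The affine projection over E and the final estimate *)

Section main_estimate.
Context {R : realType} {n : nat}.
Local Notation mu := (@lebesgue_rV R n).
Variables (Omega E : set 'rV[R]_n.+1).
Hypotheses (oO : open Omega) (bO : bounded_set Omega).
Hypotheses (mE : measurable E) (EO : E `<=` Omega) (E0 : (0 < mu E)%E).
Variables (w : 'rV[R]_n.+1 -> R) (G : 'I_n.+1 -> 'rV[R]_n.+1 -> R).
Variables (h : 'I_n.+1 -> 'I_n.+1 -> 'rV[R]_n.+1 -> R).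
Hypotheses (Lw : L2 Omega w) (LG : forall i, L2 Omega (G i)).
Hypothesis (Lh : forall i j, L2 Omega (h i j)).

(** When G and h are the first and second derivatives of w, N is the integrand of its squared
    W^{2,2} norm and m is l_E(w), with gradient q. *)
Let H x := \sum_i \sum_j h i j x ^+ 2.
Let N x := w x ^+ 2 + \sum_i G i x ^+ 2 + H x.
Let q : 'rV[R]_n.+1 := \row_i average E (G i).
Let m x := average E w + dot q (x - center_of_mass E).
Let K := Num.sqrt (2 * (vol Omega / vol E) * (1 + diam Omega ^+ 2)).

(** Instead of the triangle inequality, [sqrB_le] bounds the integrand pointwise by (1 + K) N + (1 +
    1/K) B, where the constant B bounds m^2 + |q|^2 on Omega. Jensen's inequality then bounds B
    |Omega| by K^2 times the integral of N. *)
Lemma remainder_le :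
  \int[mu]_(x in Omega) ((w x - m x) ^+ 2 + \sum_i (G i x - q 0 i) ^+ 2 + H x) <=
  (1 + K) ^+ 2 * \int[mu]_(x in Omega) N x.
Proof.
have mO := measurable_Omega oO; have Ooo := Omega_lty bO.
have Eoo : (mu E < +oo)%E by rewrite (le_lt_trans _ Ooo)// le_lebesgue_outer.
have vE := vol_gt0 E0 Eoo.
have vO : 0 < vol Omega by apply: vol_gt0 => //; rewrite (lt_le_trans E0)// le_lebesgue_outer.
have d0 : 0 < 1 + diam Omega ^+ 2 by rewrite ltr_pwDl ?sqr_ge0.
have K0 : 0 < K by rewrite sqrtr_gt0 !mulr_gt0// invr_gt0.
have K2 : K ^+ 2 = 2 * (vol Omega / vol E) * (1 + diam Omega ^+ 2).
  by rewrite sqr_sqrtr// !mulr_ge0 ?invr_ge0 ?(ltW vO) ?(ltW vE) ?(ltW d0).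
have iw2 : mu.-integrable Omega (EFin \o (fun x => w x ^+ 2)) by case: Lw.
have iG2 i : mu.-integrable Omega (EFin \o (fun x => G i x ^+ 2)) by have [] := LG i.
have ih2 i j : mu.-integrable Omega (EFin \o (fun x => h i j x ^+ 2)) by have [] := Lh i j.
have iSG := integrable_EFin_sum mO (index_enum _) iG2.
have iH : mu.-integrable Omega (EFin \o H).
  apply: (integrable_EFin_sum mO) => i; exact: (integrable_EFin_sum mO).
have iwG := integrable_EFinD mO iw2 iSG.
have iN : mu.-integrable Omega (EFin \o N) by exact: integrable_EFinD.
(* With a the average of w over E, m^2 <= 2 a^2 + 2 |q|^2 diam^2 by Cauchy-Schwarz and
   [center_of_mass_dist]; adding |q|^2 stays below B. *)
pose B := 2 * (1 + diam Omega ^+ 2) * (average E w ^+ 2 + \sum_i q 0 i ^+ 2).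
have cB := integrable_EFin_cst mO ((1 + K^-1) * B) Ooo.
have iKN := integrable_EFinZl mO (1 + K) iN.
have Lm : L2 Omega m.
  rewrite (_ : m = affine (average E w - dot q (center_of_mass E)) q); first exact: L2_affine.
  apply/funext => x; rewrite /m /affine -addrA; congr (_ + _).
  rewrite addrC /dot -sumrB; apply: eq_bigr => i _.
  by rewrite !mxE mulrBr.
have iL : mu.-integrable Omega (EFin \o (fun x =>
    (w x - m x) ^+ 2 + \sum_i (G i x - q 0 i) ^+ 2 + H x)).
  apply: integrable_EFinD => //; apply: integrable_EFinD => //.
    by have [] := L2B mO Lw Lm.
  apply: (integrable_EFin_sum mO) => i.
  by have [] := L2B mO (LG i) (L2_cst oO bO (q 0 i)).
have q2 : 0 <= \sum_i q 0 i ^+ 2 by apply: sumr_ge0 => i _; rewrite sqr_ge0.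
have H0 x : 0 <= H x.
  by apply: sumr_ge0 => i _; apply: sumr_ge0 => j _; rewrite sqr_ge0.
apply: (@le_trans _ _ (\int[mu]_(x in Omega) ((1 + K) * N x + (1 + K^-1) * B))).
  apply: le_Rintegral => //; first exact: integrable_EFinD.
  move=> x Ox.
  have hm : m x ^+ 2 + \sum_i q 0 i ^+ 2 <= B.
    have := dot_sqr_le q (x - center_of_mass E).
    have := center_of_mass_dist oO bO mE EO E0 Ox.
    rewrite (_ : \sum_i (x - center_of_mass E) 0 i ^+ 2 =
      \sum_i (x 0 i - center_of_mass E 0 i) ^+ 2); last first.
      by apply: eq_bigr => i _; rewrite !mxE.
    rewrite /m /B; set D := \sum_i _; set S := \sum_i _ ^+ 2 in q2 *.
    set a := average E w; set b := dot _ _; set dd := diam Omega ^+ 2.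
    move=> Dd bD; have bd : b ^+ 2 <= S * dd by apply: (le_trans bD); rewrite ler_wpM2l.
    have dd0 : 0 <= dd by rewrite sqr_ge0.
    have := sqr_ge0 (a - b); have := mulr_ge0 dd0 (sqr_ge0 a); nra.
  have hw := sqrB_le (w x) (m x) K0.
  have hG : \sum_i (G i x - q 0 i) ^+ 2 <=
      (1 + K) * \sum_i G i x ^+ 2 + (1 + K^-1) * \sum_i q 0 i ^+ 2.
    by rewrite !mulr_sumr -big_split/=; apply: ler_sum => i _; exact: sqrB_le.
  have hK : 0 <= 1 + K^-1 by rewrite addr_ge0// invr_ge0 ltW.
  have hB := ler_wpM2l hK hm.
  have hH : H x <= (1 + K) * H x by rewrite ler_peMl// lerDl ltW.
  rewrite /N !mulrDr; move: hB; rewrite mulrDr; lra.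
rewrite RintegralD// RintegralZl// Rintegral_cst// -/(vol Omega).
set S := \int[mu]_(x in Omega) N x.
(* The averages over E cost a factor 1/|E| and integrating the constant B costs |Omega|, whence the
   ratio in K. *)
have hB : B * vol Omega <= K ^+ 2 * S.
  have h1 : average E w ^+ 2 + \sum_i q 0 i ^+ 2 <= (vol E)^-1 * S.
    apply: (@le_trans _ _ ((vol E)^-1 * \int[mu]_(x in Omega) (w x ^+ 2 + \sum_i G i x ^+ 2))).
      rewrite RintegralD// Rintegral_sum// mulrDr mulr_sumr; apply: lerD.
        apply: le_trans (average_sqr_le mE E0 Eoo (L2_S mO mE EO Lw)) _.
        rewrite ler_wpM2l ?invr_ge0 ?(ltW vE)//; apply: Rintegral_subset => // x _.
        exact: sqr_ge0.
      apply: ler_sum => i _; rewrite mxE.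
      apply: le_trans (average_sqr_le mE E0 Eoo (L2_S mO mE EO (LG i))) _.
      rewrite ler_wpM2l ?invr_ge0 ?(ltW vE)//; apply: Rintegral_subset => // x _.
      exact: sqr_ge0.
    rewrite ler_wpM2l ?invr_ge0 ?(ltW vE)//; apply: le_Rintegral => // x _.
    by rewrite /N lerDl.
  rewrite K2 /B.
  rewrite (_ : 2 * (vol Omega / vol E) * (1 + diam Omega ^+ 2) * S =
    2 * (1 + diam Omega ^+ 2) * ((vol E)^-1 * S) * vol Omega); last by ring.
  by rewrite ler_wpM2r ?(ltW vO)// ler_wpM2l// mulr_ge0// ltW.
have hK : 0 <= 1 + K^-1 by rewrite addr_ge0// invr_ge0 ltW.
have := ler_wpM2l hK hB; rewrite mulrA => h1.
apply: (le_trans (lerD (lexx _) h1)).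
(* The weights combine as (1 + K) + (1 + 1/K) K^2 = (1 + K)^2. *)
rewrite le_eqVlt; apply/orP; left; apply/eqP.
by field; rewrite gt_eqF.
Qed.

End main_estimate.

Theorem mainTheorem6 (R : realType) (n : nat)
    (Omega E : set 'rV[R]_n.+1) (Q : R) :
  open Omega -> connected Omega -> bounded_set Omega ->
  lipschitz_boundary Omega ->
  measurable E -> E `<=` Omega -> (0 < lebesgue_rV E)%E ->
  0 < Q ->
  (forall u : 'rV[R]_n.+1 -> R, sobolev 1 Omega u ->
     L2norm Omega (fun x => u x - average Omega u) <=
     Q * L2norm Omega (fun x => enorm (grad Omega u x))) ->
  forall u : 'rV[R]_n.+1 -> R, sobolev 2 Omega u ->
    W22norm Omega (fun x => u x -
      (average E u + dot (vaverage E (grad Omega u)) (x - center_of_mass E))) <=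
    (1 + Num.sqrt (2 * (vol Omega / vol E) * (1 + diam Omega ^+ 2))) *
    Num.sqrt (1 + Q ^+ 2 + Q ^+ 4) *
    L2norm Omega (fun x => enorm (hess Omega u x)).
Proof.
move=> oO _ bO _ mE EO E0 Q0 PQ u su.
have mO := measurable_Omega oO; have Ooo := Omega_lty bO.
have Eoo : (lebesgue_rV E < +oo)%E by rewrite (le_lt_trans _ Ooo)// le_lebesgue_outer.
pose g i := weak_partials Omega [:: i] u.
pose h i j := weak_partials Omega [:: i; j] u.
have [Lu _] := su.
have Lg i : L2 Omega (g i) by have [] := @sobolev_weak_partials _ _ 2 _ [:: i] _ oO su isT.
have wg i : is_weak_partials Omega [:: i] u (g i).
  by have [] := @sobolev_weak_partials _ _ 2 _ [:: i] _ oO su isT.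
have Lh i j : L2 Omega (h i j).
  by have [] := @sobolev_weak_partials _ _ 2 _ [:: i; j] _ oO su isT.
have wh i j : is_weak_partials Omega [:: i; j] u (h i j).
  by have [] := @sobolev_weak_partials _ _ 2 _ [:: i; j] _ oO su isT.
pose p : 'rV[R]_n.+1 := \row_i average Omega (g i).
pose G i x := g i x - p 0 i.
pose w0 x := u x - affine 0 p x.
pose c := average Omega w0.
(* As w is w0 minus its average, it is the function on the left of the Poincare inequality for w0;
   likewise each G i comes from g i. *)
pose w x := w0 x - c.
have LG i : L2 Omega (G i) by apply: L2B mO (Lg i) (L2_cst oO bO _).
have Lw0 : L2 Omega w0 by apply: L2B mO Lu (L2_affine oO bO _ _).
have Lw : L2 Omega w by apply: L2B mO Lw0 (L2_cst oO bO _).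
pose I := \int[lebesgue_rV]_(x in Omega) (\sum_i \sum_j h i j x ^+ 2).
have ih2 i j : lebesgue_rV.-integrable Omega (EFin \o (fun x => h i j x ^+ 2)).
  by have [] := Lh i j.
have ihS i := integrable_EFin_sum mO (index_enum _) (ih2 i).
have iH := integrable_EFin_sum mO (index_enum _) ihS.
have iG2 i : lebesgue_rV.-integrable Omega (EFin \o (fun x => G i x ^+ 2)).
  by have [] := LG i.
have iSG := integrable_EFin_sum mO (index_enum _) iG2.
have iw2 : lebesgue_rV.-integrable Omega (EFin \o (fun x => w x ^+ 2)) by case: Lw.
have I0 : 0 <= I.
  apply: Rintegral_ge0 => x _.
  by apply: sumr_ge0 => i _; apply: sumr_ge0 => j _; rewrite sqr_ge0.
(* Poincare for each g i, whose weak derivatives are the h i j, summed over i. *)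
have hG : \int[lebesgue_rV]_(x in Omega) (\sum_i G i x ^+ 2) <= Q ^+ 2 * I.
  rewrite /I !Rintegral_sum// mulr_sumr; apply: ler_sum => i _.
  have := @poincare_sqr _ _ _ oO Q (g i) (h i) Q0 PQ (Lg i) (Lh i)
    (fun j => is_weak_partials_cons (wg i) (wh i j)).
  apply: le_trans; rewrite le_eqVlt; apply/orP; left; apply/eqP.
  by apply: eq_Rintegral => x _; rewrite /G mxE.
(* Poincare for w0, whose weak gradient is G, followed by [hG], gives Q^2 twice. *)
have hw : \int[lebesgue_rV]_(x in Omega) w x ^+ 2 <= Q ^+ 4 * I.
  have ww j : is_weak_partials Omega [:: j] w0 (G j).
    exact: is_weak_partialsB oO (wg j) (affine_weak_partial 0 p j oO).
  have := @poincare_sqr _ _ _ oO Q w0 G Q0 PQ Lw0 LG ww => /le_trans; apply.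
  rewrite (_ : Q ^+ 4 * I = Q ^+ 2 * (Q ^+ 2 * I)); last by ring.
  by rewrite ler_wpM2l// sqr_ge0.
pose p' := vaverage E (grad Omega u).
(* Collecting the constant terms puts l_E(u) in the form [affine c' p']. *)
pose c' := average E u - dot p' (center_of_mass E).
have p'E i : p' 0 i = average E (g i).
  rewrite /p' /vaverage mxE; congr average; apply/funext => x.
  by rewrite /grad mxE.
have UE : (fun x => u x - (average E u + dot (vaverage E (grad Omega u))
    (x - center_of_mass E))) = (fun x => u x - affine c' p' x).
  apply/funext => x; rewrite /affine /c' -/p' -addrA; congr (_ - (_ + _)).
  by rewrite addrC /dot -sumrB; apply: eq_bigr => i _; rewrite !mxE mulrBr.
have LU : L2 Omega (fun x => u x - affine c' p' x) by apply: L2B mO Lu (L2_affine oO bO _ _).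
(* The subtracted 0 is the second derivative of the affine part, in the shape given by
   [is_weak_partialsB]. *)
rewrite UE (@W22norm_sqr _ _ _ oO _ (fun i x => g i x - p' 0 i) (fun i j x => h i j x - 0)).
- pose q : 'rV[R]_n.+1 := \row_i average E (G i).
  have ci i : lebesgue_rV.-integrable E (EFin \o (fun x : 'rV[R]_n.+1 => x 0 i)).
    exact: (L2_integrable mE Eoo (L2_S mO mE EO (L2_coord oO bO i))).
  have qE i : q 0 i = p' 0 i - p 0 i.
    rewrite mxE averageB//.
    + by rewrite average_cst// p'E.
    + exact: (L2_integrable mE Eoo (L2_S mO mE EO (Lg i))).
    + exact: (integrable_EFin_cst mE).
  have wE : average E w = average E u - dot p (center_of_mass E) - c.
    rewrite averageB//; first last.
    + exact: (integrable_EFin_cst mE).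
    + exact: (L2_integrable mE Eoo (L2_S mO mE EO Lw0)).
    rewrite average_cst// averageB//; first last.
    + exact: (L2_integrable mE Eoo (L2_S mO mE EO (L2_affine oO bO _ _))).
    + exact: (L2_integrable mE Eoo (L2_S mO mE EO Lu)).
    by rewrite average_affine// /affine add0r.
  have := remainder_le oO bO mE EO E0 Lw LG Lh; rewrite -/q.
  set K := Num.sqrt _; set T := (X in X <= _) => hT.
  have K0 : 0 <= K by rewrite sqrtr_ge0.
  have hess_I : \int[lebesgue_rV]_(x in Omega) enorm (hess Omega u x) ^+ 2 = I.
    apply: eq_Rintegral => x _; rewrite enorm_sqr.
    by apply: eq_bigr => i _; apply: eq_bigr => j _; rewrite mxE.
  rewrite /L2norm hess_I.
  (* All constants are gathered under one square root, so that squared quantities can be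
     compared. *)
  rewrite -mulrA -sqrtrM; last by rewrite !addr_ge0// ?sqr_ge0// exprn_ge0// ltW.
  rewrite -[X in X * _]ger0_norm ?addr_ge0// -sqrtr_sqr -sqrtrM ?sqr_ge0//.
  rewrite ler_sqrt; last first.
    by rewrite !mulr_ge0 ?sqr_ge0// !addr_ge0 ?sqr_ge0// exprn_ge0// ltW.
  (* Here u - l_E(u) = w - l_E(w) pointwise, and similarly for the gradients: by [wE] and [qE] the
     affine function subtracted from u cancels. *)
  apply: (@le_trans _ _ T).
    rewrite le_eqVlt; apply/orP; left; apply/eqP; apply: eq_Rintegral => x _.
    congr (_ ^+ 2 + _ + _).
    + rewrite wE /w /w0 /affine /c'.
      have -> : dot q (x - center_of_mass E) = dot p' x - dot p' (center_of_mass E) -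
          (dot p x - dot p (center_of_mass E)).
        rewrite /dot -!sumrB; apply: eq_bigr => i _; rewrite qE !mxE; ring.
      ring.
    + by apply: eq_bigr => i _; rewrite /G qE; congr (_ ^+ 2); ring.
    + by apply: eq_bigr => i _; apply: eq_bigr => j _; rewrite subr0.
  apply: (le_trans hT); rewrite ler_wpM2l ?sqr_ge0//.
  (* The integral of N splits into three parts, bounded by Q^4 I, Q^2 I and I. *)
  rewrite RintegralD//; last exact: integrable_EFinD.
  rewrite RintegralD//.
  rewrite -/I; move: hG hw; lra.
- by case: LU.
- by move=> i; exact: is_weak_partialsB oO (wg i) (affine_weak_partial c' p' i oO).
- by move=> i j; exact: is_weak_partialsB oO (wh i j) (affine_weak_partial2 c' p' i j oO).
Qed.
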